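(* Let $k=\sum_{j=1}^\ell k_j<N$. Assume $u(x)=\tilde g(|x|^2)\in L^\infty(\mathbb{R}^N)$ is such that $\tilde g$ is convex. Then for any $x\ne0$ $$\mathcal{K}^-_{k_1,\dots,k_\ell}u(x)=\sum_{i=1}^\ell\mathcal{J}_{\langle\eta^i_j\rangle_{j=1}^{k_i}}u(x)=\frac{\sum_{i=1}^\ell C_{k_i,s}}{C_{1,s}}\;\mathcal{I}_{x^\perp}u(x),$$ where $\bigcup_{i=1}^\ell\{\eta^i_j\}_{j=1}^{k_i}$ is any orthonormal set of $k$ vectors in $\mathbb{R}^N$ such that each $\eta^i_j$ is orthogonal to $x$, and $x^\perp$ is any unit vector orthogonal to $x$.
   Context: Fix $N\in\mathbb{N}$, $s\in(0,1)$, $1\le\ell\le N$ and integers $1\le k_1\le\dots\le k_\ell\le N$ with $\sum_{j=1}^\ell k_j\le N$. Here $\tilde g:[0,\infty)\to\mathbb{R}$, and $\langle\cdot\rangle$ denotes linear span. For an $n$-dimensional linear subspace $V\subset\mathbb{R}^N$, $$\mathcal{J}_Vu(x)=C_{n,s}\,P.V.\int_V\frac{u(x+z)-u(x)}{|z|^{n+2s}}\,d\mathcal{H}^n(z),$$ where $\mathcal{H}^n$ is the $n$-dimensional Hausdorff measure and $C_{n,s}>0$ is a normalizing constant depending only on $n,s$. For a unit vector $\xi$, $\mathcal{I}_\xi u(x):=\mathcal{J}_{\langle\xi\rangle}u(x)=C_{1,s}\int_0^{+\infty}\frac{u(x+\tau\xi)+u(x-\tau\xi)-2u(x)}{\tau^{1+2s}}d\tau$.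 The quantity $\mathcal{K}^-_{k_1,\dots,k_\ell}u(x)$ is the infimum of $\sum_{i=1}^\ell\mathcal{J}_{V_i}u(x)$ over all families $(V_1,\dots,V_\ell)$ of pairwise orthogonal linear subspaces of $\mathbb{R}^N$ with $\dim V_i=k_i$.
   Formalization: In the last equality each C_{k_i,s} is multiplied by the area of the unit sphere S^{k_i-1} and C_{1,s} by that of S^0 (which is 2); without these factors the printed quotient is false, e.g. for N=3, l=1, k_1=2, g(t)=exp(-t). For all k_i=1 it is the printed formula. *)

(* Defs.v *)
From HB Require Import structures.
From mathcomp Require Import all_boot all_order all_algebra.
From mathcomp Require Import all_classical all_reals all_analysis.

Set Implicit Arguments.
Unset Strict Implicit.
Unset Printing Implicit Defensive.

Import Order.TTheory GRing.Theory Num.Theory.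
Import numFieldNormedType.Exports.

Local Open Scope classical_set_scope.
Local Open Scope ring_scope.

Section Euclidean.
Context {R : realType} {N : nat}.
Implicit Types u v : 'rV[R]_N.

Definition dot u v : R := \sum_(i < N) u 0 i * v 0 i.

(* The library norm on row vectors is the sup norm. *)
Definition enorm u : R := Num.sqrt (dot u u).

Definition orthogonal_spaces (V W : {vspace 'rV[R]_N}) : Prop :=
  forall v w, v \in V -> w \in W -> dot v w = 0.

Definition diam (A : set 'rV[R]_N) : \bar R :=
  ereal_sup [set (enorm (p.1 - p.2))%:E | p in A `*` A].

End Euclidean.

(* Volume of the unit ball of R^n, pi^(n/2) / Gamma(n/2 + 1), through
   |B^(n+2)| = 2 pi / (n+2) * |B^n|. *)
Fixpoint ball_volume {R : realType} (n : nat) : R :=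
  match n with
  | 0 => 1
  | 1 => 2
  | S (S m) => 2 * pi / m.+2%:R * ball_volume m
  end.

Lemma ball_volume_ge0 {R : realType} n : 0 <= ball_volume n :> R.
Proof.
suff : 0 <= ball_volume n :> R /\ 0 <= ball_volume n.+1 :> R by case.
elim: n => [|n [h1 h2]]; first by split => /=.
split => //=; apply: mulr_ge0 => //.
by rewrite divr_ge0// mulr_ge0// pi_ge0.
Qed.

Section Hausdorff.
Context {R : realType} {N : nat}.
Implicit Types A B : set 'rV[R]_N.
Local Open Scope ereal_scope.

(* The empty set is treated apart so that it weighs 0 also when n = 0. *)
Definition hausdorff_gauge (n : nat) A : \bar R :=
  if A == set0 then 0 else (ball_volume n / 2 ^+ n)%:E * diam A ^+ n.

Definition fine_cover (d : R) A : set ((set 'rV[R]_N)^nat) :=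
  [set U | A `<=` \bigcup_k U k /\ forall k, diam (U k) <= d%:E].

Definition hausdorff_size (n : nat) (d : R) A : \bar R :=
  ereal_inf [set \sum_(k <oo) hausdorff_gauge n (U k) | U in fine_cover d A].

Definition hausdorff (n : nat) A : \bar R :=
  ereal_sup [set hausdorff_size n d A | d in [set d : R | (0 < d)%R]].

Lemma diam_ge0 A : A != set0 -> 0 <= diam A.
Proof.
move=> /set0P[x Ax]; apply: ereal_sup_ubound; exists (x, x) => //=.
rewrite subrr /enorm /dot big1 ?sqrtr0// => i _.
by rewrite !mxE mulr0.
Qed.

Lemma hausdorff_gauge_ge0 n A : 0 <= hausdorff_gauge n A.
Proof.
rewrite /hausdorff_gauge; have [//|A0] := eqVneq A set0.
apply: mule_ge0; first by rewrite lee_fin divr_ge0 ?ball_volume_ge0// exprn_ge0.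
by apply: expe_ge0; exact: diam_ge0.
Qed.

Lemma hausdorff_gauge0 n : hausdorff_gauge n set0 = 0.
Proof. by rewrite /hausdorff_gauge eqxx. Qed.

Lemma hausdorff_size_ge0 n d A : 0 <= hausdorff_size n d A.
Proof.
by apply: le_ereal_inf_tmp => _ [U _ <-]; apply: nneseries_ge0 => k _ _;
  exact: hausdorff_gauge_ge0.
Qed.

Lemma hausdorff_size_le n d A : (0 < d)%R ->
  hausdorff_size n d A <= hausdorff n A.
Proof. by move=> d0; apply: ereal_sup_ubound; exists d. Qed.

Lemma hausdorff_ge0 n A : 0 <= hausdorff n A.
Proof.
exact: le_trans (hausdorff_size_ge0 n 1 A) (hausdorff_size_le n A ltr01).
Qed.

Lemma hausdorff0 n : hausdorff n set0 = 0.
Proof.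
apply/eqP; rewrite eq_le hausdorff_ge0 andbT.
apply: ge_ereal_sup => _ [d d0 <-].
apply: ereal_inf_lbound; exists (fun=> set0); last first.
  by apply: eseries0 => k _ _; exact: hausdorff_gauge0.
split => // k; rewrite /diam setX0 image_set0 ereal_sup0; exact: leNye.
Qed.

Lemma le_hausdorff n : {homo hausdorff n : A B / A `<=` B >-> A <= B}.
Proof.
move=> A B AB; apply: ge_ereal_sup => _ [d d0 <-].
apply: le_trans (hausdorff_size_le n B d0).
apply/ereal_inf_le_tmp => _ [U [BU dU] <-].
by exists U => //; split => //; exact: subset_trans BU.
Qed.

Lemma hausdorff_size_subadditive n d : sigma_subadditive (hausdorff_size n d).
Proof.
move=> A; have [[i ioo]|] := pselect (exists i, hausdorff_size n d (A i) = +oo).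
  rewrite (eseries_pinfty _ _ ioo) ?leey// => k _.
  by rewrite -ltNye (lt_le_trans _ (hausdorff_size_ge0 _ _ _)).
rewrite -forallNE => Aoo.
apply/lee_addgt0Pr => _/posnumP[e].
rewrite (le_trans _ (epsilon_trick _ _ _))//; last first.
  by move=> k; exact: hausdorff_size_ge0.
pose P k (B : (set 'rV[R]_N)^nat) := fine_cover d (A k) B /\
  \sum_(j <oo) hausdorff_gauge n (B j) <=
    hausdorff_size n d (A k) + (e%:num / (2 ^ k.+1)%:R)%:E.
have [G PG] : {G : ((set 'rV[R]_N)^nat)^nat & forall k, P k (G k)}.
  apply: (@choice _ _ P) => k; rewrite /P.
  have en1 : (0 < e%:num / (2 ^ k.+1)%:R)%R by [].
  have fk : hausdorff_size n d (A k) \is a fin_num.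
    rewrite ge0_fin_numE ?hausdorff_size_ge0//.
    by rewrite ltey; apply/eqP; exact: Aoo.
  have [_ [B AB <-] /ltW BA] := lb_ereal_inf_adherent en1 fk.
  by exists B.
have muG_ge0 x : 0 <= (hausdorff_gauge n \o uncurry G) x by exact: hausdorff_gauge_ge0.
apply: (@le_trans _ _ (\esum_(i in setT) (hausdorff_gauge n \o uncurry G) i)).
  apply: ereal_inf_lbound => /=.
  have /card_esym/ppcard_eqP[f] := card_nat2.
  exists (uncurry G \o f).
    split => [t [i _ Ait]|i].
      have [j _ Gt] := (PG i).1.1 _ Ait.
      by exists (f^-1%FUN (i, j)) => //=; rewrite invK ?inE.
    by rewrite /=; case: (f i) => a b; exact: (PG a).1.2.
  rewrite -(esum_pred_image (hausdorff_gauge n \o uncurry G) _ xpredT) ?[fun=> _]set_true//.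
  by rewrite image_eq.
rewrite (_ : esum _ _ = \sum_(i <oo) \sum_(j <oo) hausdorff_gauge n (G i j)); last first.
  pose J : nat -> set (nat * nat) := fun i => [set (i, j) | j in setT].
  rewrite (_ : setT = \bigcup_k J k); last first.
    by rewrite predeqE => -[a b]; split => // _; exists a => //; exists b.
  rewrite esum_bigcupT /=; last 2 first.
    - apply/trivIsetP => i j _ _ ij.
      rewrite predeqE => -[p m] /=; split => //= -[] [_] _ [<-{p} _].
      by move=> [m' _] [] /esym/eqP; rewrite (negbTE ij).
    - by move=> /= [p m]; exact: hausdorff_gauge_ge0.
  rewrite -(image_id [set: nat]) -fun_true esum_pred_image//; last first.
    by move=> p _; apply: esum_ge0 => ? _; exact: hausdorff_gauge_ge0.
  apply: eq_eseriesr => /= j _.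
  rewrite -(esum_pred_image (hausdorff_gauge n \o uncurry G) (pair j) predT)//=; last 2 first.
    - by move=> ? _; exact: hausdorff_gauge_ge0.
    - by move=> ? ? _ _; exact: (@can_inj _ _ _ snd).
  by congr esum; rewrite predeqE => -[a b]; split; move=> [i _ <-]; exists i.
apply: lee_nneseries => [k _ _|k _]; last by have [] := PG k.
by apply: nneseries_ge0 => j _ _; exact: hausdorff_gauge_ge0.
Qed.

Lemma hausdorff_sigma_subadditive n : sigma_subadditive (hausdorff n).
Proof.
move=> A; apply: ge_ereal_sup => _ [d d0 <-].
apply: le_trans (hausdorff_size_subadditive n d A) _.
apply: lee_nneseries => [k _ _|k _]; first exact: hausdorff_size_ge0.
exact: hausdorff_size_le.
Qed.

HB.instance Definition _ n := isOuterMeasure.Build R 'rV[R]_N (hausdorff n)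
  (hausdorff0 n) (hausdorff_ge0 n) (@le_hausdorff n)
  (@hausdorff_sigma_subadditive n).

End Hausdorff.

Definition hausdorff_outer (R : realType) (N n : nat) :
  {outer_measure set 'rV[R]_N -> \bar R} := @hausdorff R N n.

(* Copy of R^N with the Caratheodory-measurable sets as sigma-algebra. *)
Notation hausdorff_mspace R N n := (caratheodory_type (hausdorff_outer R N n)).

(* For n = N this is the Lebesgue measure of R^N. *)
Definition hausdorff_measure (R : realType) (N n : nat) :
    {measure set (hausdorff_mspace R N n) -> \bar R} :=
  (hausdorff_outer R N n : set (hausdorff_mspace R N n) -> \bar R).

(* |S^(n-1)| = n |B^n|: in polar coordinates, the integral over an n-space of a
   function of |z| is sphere_area n times its integral against r^(n-1) dr. *)
Definition sphere_area (R : realType) (n : nat) : R :=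
  n%:R * fine (hausdorff n [set z : 'rV[R]_n | enorm z <= 1]).

Section Operators.
Context {R : realType} {N : nat}.
Variables (C : nat -> R -> R) (s : R).
Implicit Types (V : {vspace 'rV[R]_N}) (u : 'rV[R]_N -> R) (x xi : 'rV[R]_N).
Local Open Scope ereal_scope.

Definition truncJ V u x (eps : R) : \bar R :=
  \int[hausdorff_measure R N (\dim V)]_(z in
      [set z : 'rV[R]_N | z \in V /\ (eps < enorm z)%R])
    ((u (x + z) - u x) / enorm z `^ ((\dim V)%:R + 2 * s))%:E.

(* The principal value is a limit in the extended real line: at a kink of u it
   may be +oo. *)
Definition Jop V u x : \bar R :=
  (C (\dim V) s)%:E * lim (truncJ V u x eps @[eps --> 0%R^'+]).

(* With n = 1 the truncated integrals are those of the second differences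
   (u (x + t xi) + u (x - t xi) - 2 u x) / t^(1 + 2 s) over t > eps. *)
Definition Iop xi u x : \bar R := Jop <[xi]>%VS u x.

Definition orthogonal_family (l : nat) (k : 'I_l -> nat)
    (V : 'I_l -> {vspace 'rV[R]_N}) : Prop :=
  (forall i, \dim (V i) = k i) /\
  (forall i j, i != j -> orthogonal_spaces (V i) (V j)).

Definition Kminus (l : nat) (k : 'I_l -> nat) u x : \bar R :=
  ereal_inf [set \sum_(i < l) Jop (V i) u x | V in orthogonal_family k].

End Operators.

(* Main.v *)
Require Import Defs.
From HB Require Import structures.
From mathcomp Require Import all_boot all_order all_algebra.
From mathcomp Require Import finmap.
From mathcomp Require Import all_classical all_reals all_analysis.
From mathcomp Require Import measurable_realfun ess_sup_inf.
From mathcomp Require Import ring lra.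

(** The profile [g] is convex and essentially bounded, hence nonincreasing and
    bounded on [0, +oo[: if it increased somewhere it would tend to +oo, and once
    nonincreasing, if it fell below an essential lower bound it would stay there;
    either would violate the essential bounds on the exterior of a ball, which is
    not negligible.

    Fix a subspace [V] of dimension [n] and put
    [decay r = g (|x|^2) - g (|x|^2 + r^2)], a nonnegative nondecreasing
    function of [r >= 0].  For [z] in [V] one has
    [|x + z|^2 = |x|^2 + |z|^2 + 2 <x, z>], and convexity at the midpoint
    [|x|^2 + |z|^2] of [|x + z|^2] and [|x - z|^2] gives
    [u (x + z) + u (x - z) - 2 u x >= - 2 decay |z|].  Integrating against
    [|z|^-(n + 2s)] over [V] outside a ball, and using that the measure is
    invariant under [z |-> - z], the truncated integral defining [J_V u x] is at
    least minus the integral of [decay |z| / |z|^(n + 2s)] (lemma [truncJ_ge]).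
    When [V] is orthogonal to [x] the term [<x, z>] vanishes and this is an
    equality (lemma [truncJ_orthogonal]).

    The lower bound depends on [V] through its dimension only, by a factor equal
    to the area of the unit sphere (lemma [radial_int_dim]).  Instead of polar
    coordinates, the proof cuts the exterior of the ball of radius [e] into the
    rings [e q^j < |z| <= e q^(j+1)], with [q > 1], whose measures are known by
    scaling.  As [decay] is monotone, the integral over the exterior lies between
    two multiples of the series of [decay r * r^-(2s)] at the radii [r = e q^j].
    This series is the same in every dimension, and the multiples for two
    dimensions compare, as [q -> 1], in the ratio of the sphere areas.

    Hence each [J_{V_i}] is minimised, separately, by a subspace orthogonal to
    [x], and its value there is [C (k_i) s] times the sphere area ratio times a
    line integral common to all [i]; summing over [i] yields both equalities.

    What has to be known about Hausdorff measure is proved along the way: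
    Lipschitz functions are measurable for it (Caratheodory's criterion), it
    scales and is invariant under isometries, and the cube of R^n has finite and
    positive n-dimensional measure. *)

Set Implicit Arguments.
Unset Strict Implicit.
Unset Printing Implicit Defensive.

Import Order.TTheory GRing.Theory Num.Theory.
Import numFieldNormedType.Exports.

Local Open Scope classical_set_scope.
Local Open Scope ring_scope.

(** * Euclidean geometry of row vectors *)

Section Euclid.
Context {R : realType} {N : nat}.
Implicit Types u v w : 'rV[R]_N.

Lemma dotC u v : dot u v = dot v u.
Proof. by apply: eq_bigr => i _; rewrite mulrC. Qed.

Lemma dotDl u v w : dot (u + v) w = dot u w + dot v w.
Proof. by rewrite -big_split; apply: eq_bigr => i _; rewrite mxE mulrDl. Qed.

Lemma dotZl a u w : dot (a *: u) w = a * dot u w.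
Proof. by rewrite /dot mulr_sumr; apply: eq_bigr => i _; rewrite mxE mulrA. Qed.

Lemma dotNl u w : dot (- u) w = - dot u w.
Proof. by rewrite -scaleN1r dotZl mulN1r. Qed.

Lemma dot0l w : dot 0 w = 0.
Proof. by rewrite -(scale0r 0) dotZl mul0r. Qed.

Lemma dot_suml I (r : seq I) (P : pred I) (F : I -> 'rV[R]_N) w :
  dot (\sum_(i <- r | P i) F i) w = \sum_(i <- r | P i) dot (F i) w.
Proof.
by apply: (big_morph (fun u => dot u w)) => [u v|]; [exact: dotDl|exact: dot0l].
Qed.

Lemma dotDr u v w : dot w (u + v) = dot w u + dot w v.
Proof. by rewrite dotC dotDl !(dotC w). Qed.

Lemma dotZr a u w : dot w (a *: u) = a * dot w u.
Proof. by rewrite dotC dotZl dotC. Qed.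

Lemma dotNr u w : dot w (- u) = - dot w u.
Proof. by rewrite dotC dotNl dotC. Qed.

Lemma dot_sumr I (r : seq I) (P : pred I) (F : I -> 'rV[R]_N) w :
  dot w (\sum_(i <- r | P i) F i) = \sum_(i <- r | P i) dot w (F i).
Proof. by rewrite dotC dot_suml; apply: eq_bigr => i _; rewrite dotC. Qed.

Lemma dot_ge0 u : 0 <= dot u u.
Proof. by apply: sumr_ge0 => i _; rewrite -expr2 sqr_ge0. Qed.

Lemma dot_eq0 u : dot u u = 0 -> u = 0.
Proof.
move=> /eqP; rewrite psumr_eq0 => [/allP h|i _]; last by rewrite -expr2 sqr_ge0.
apply/rowP => i; rewrite mxE; apply/eqP.
by have := h i (mem_index_enum i); rewrite mulf_eq0 orbb.
Qed.

Lemma enorm_ge0 u : 0 <= enorm u.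
Proof. exact: sqrtr_ge0. Qed.

Lemma enorm_sqr u : enorm u ^+ 2 = dot u u.
Proof. by rewrite sqr_sqrtr// dot_ge0. Qed.

Lemma enorm0 : enorm (0 : 'rV[R]_N) = 0.
Proof. by rewrite /enorm dot0l sqrtr0. Qed.

Lemma enorm_eq0 u : enorm u = 0 -> u = 0.
Proof. by move=> u0; apply: dot_eq0; rewrite -enorm_sqr u0 expr0n. Qed.

Lemma enormZ a u : enorm (a *: u) = `|a| * enorm u.
Proof.
by rewrite /enorm dotZl dotZr mulrA -expr2 sqrtrM ?sqr_ge0// sqrtr_sqr.
Qed.

Lemma enormN u : enorm (- u) = enorm u.
Proof. by rewrite -scaleN1r enormZ normrN1 mul1r. Qed.

Lemma cauchy_schwarz u v : `|dot u v| <= enorm u * enorm v.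
Proof.
rewrite -(@ler_pXn2r _ 2)// ?nnegrE ?mulr_ge0 ?enorm_ge0//.
rewrite exprMn !enorm_sqr real_normK ?num_real//.
have [u0|u0] := eqVneq (dot u u) 0.
  by rewrite (dot_eq0 u0) !dot0l expr0n mul0r.
have upos : 0 < dot u u by rewrite lt_neqAle eq_sym u0 dot_ge0.
have := dot_ge0 (dot u u *: v - dot u v *: u).
rewrite dotDl !dotDr !dotNl !dotNr !dotZl !dotZr (dotC v u) => h.
rewrite -subr_ge0 -(pmulr_rge0 _ upos); apply: le_trans h _.
by rewrite le_eqVlt; apply/orP; left; apply/eqP; ring.
Qed.

Lemma enormD u v : enorm (u + v) <= enorm u + enorm v.
Proof.
rewrite -(@ler_pXn2r _ 2)// ?nnegrE ?addr_ge0 ?enorm_ge0//.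
rewrite sqrrD !enorm_sqr dotDl !dotDr (dotC v u).
have := le_trans (ler_norm _) (cauchy_schwarz u v); lra.
Qed.

Lemma enormB_le u v : enorm u - enorm v <= enorm (u - v).
Proof. by rewrite lerBlDr (le_trans _ (enormD _ _))// subrK. Qed.

Lemma coord_le_enorm u i : `|u 0 i| <= enorm u.
Proof.
rewrite -(@ler_pXn2r _ 2)// ?nnegrE ?enorm_ge0// enorm_sqr real_normK ?num_real// /dot.
by rewrite (bigD1 i)//= -expr2 lerDl sumr_ge0// => j _; rewrite -expr2 sqr_ge0.
Qed.

Lemma enorm_le_coord u d : 0 <= d -> (forall i, `|u 0 i| <= d) ->
  enorm u <= N%:R * d.
Proof.
move=> d0 ud; rewrite -(@ler_pXn2r _ 2)// ?nnegrE ?enorm_ge0 ?mulr_ge0//.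
rewrite enorm_sqr exprMn.
apply: (@le_trans _ _ (\sum_(i < N) d ^+ 2)).
  apply: ler_sum => i _; rewrite -expr2 -[leLHS]real_normK ?num_real//.
  by rewrite ler_pXn2r ?nnegrE.
rewrite sumr_const card_ord -[leLHS]mulr_natl ler_wpM2r ?sqr_ge0//.
by rewrite -natrX ler_nat; case: (N) => // m; rewrite leq_pmulr.
Qed.

Definition dot_orthonormal (bs : seq 'rV[R]_N) :=
  forall i j, (i < size bs)%N -> (j < size bs)%N ->
    dot bs`_i bs`_j = (i == j)%:R.

Definition projection (bs : seq 'rV[R]_N) v :=
  \sum_(i < size bs) dot v bs`_i *: bs`_i.

Lemma projection_span bs v : projection bs v \in <<bs>>%VS.
Proof. by apply: memv_suml => i _; apply/memvZ/memv_span/mem_nth. Qed.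

Lemma projection_defect bs v j : dot_orthonormal bs -> (j < size bs)%N ->
  dot (v - projection bs v) bs`_j = 0.
Proof.
move=> bsO jb; rewrite dotDl dotNl /projection dot_suml.
rewrite (bigD1 (Ordinal jb))//= dotZl.
rewrite bsO// eqxx mulr1 big1 ?addr0 ?subrr// => i ij.
by rewrite dotZl bsO// (_ : (i == j :> nat) = false) ?mulr0//; apply/negbTE.
Qed.

Lemma gram_schmidt (vs : seq 'rV[R]_N) :
  exists2 bs, dot_orthonormal bs & <<bs>>%VS = <<vs>>%VS.
Proof.
elim: vs => [|v vs [bs bsO bsE]]; first by exists [::].
pose p := projection bs v; have pbs := projection_span bs v.
have sE : <<v :: vs>>%VS = <<v - p :: bs>>%VS.
  rewrite !span_cons -bsE; apply/eqP; rewrite eqEsubv !subv_add !addvSr !andbT.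
  rewrite -!memvE; apply/andP; split.
    by rewrite -[X in X \in _](subrK p) memv_add ?memv_line.
  by apply: memvB; [exact: (subvP (addvSl _ _) _ (memv_line _))
                 |exact: (subvP (addvSr _ _) _ pbs)].
have orth j : (j < size bs)%N -> dot (v - p) bs`_j = 0.
  exact: projection_defect.
have [vp|vp] := eqVneq (v - p) 0.
  by exists bs => //; rewrite sE vp span_cons (_ : <[0]>%VS = 0%VS) ?add0v//;
    apply/eqP; rewrite -subv0 -memvE mem0v.
have np : enorm (v - p) != 0 by apply: contra_neq vp => /enorm_eq0.
exists ((enorm (v - p))^-1 *: (v - p) :: bs); last first.
  rewrite sE !span_cons; congr (_ + _)%VS; apply/eqP; rewrite eqEsubv -!memvE.
  rewrite memvZ ?memv_line//= -[X in X \in _](scalerKV np) memvZ//.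
  by rewrite memv_line.
move=> [|i] [|j] /=; rewrite ?ltnS => ib jb.
- rewrite dotZl dotZr -enorm_sqr mulrA -invfM expr2 mulVf// mulf_neq0//.
- by rewrite dotZl orth// mulr0.
- by rewrite dotZr dotC orth// mulr0.
- by rewrite bsO.
Qed.

Lemma dot_orthonormal_coord bs v : dot_orthonormal bs -> v \in <<bs>>%VS ->
  v = projection bs v.
Proof.
move=> bsO vb.
have := coord_span (X := in_tuple bs) vb => vE.
rewrite {1}vE /projection; apply: eq_bigr => i _; congr (_ *: _).
rewrite [in RHS]vE dot_suml (bigD1 i)//= dotZl ?bsO//.
rewrite eqxx mulr1 big1 ?addr0// => j ji.
by rewrite dotZl bsO// (_ : (j == i :> nat) = false) ?mulr0//; apply/negbTE.
Qed.

Lemma dot_orthonormal_free bs : dot_orthonormal bs -> free bs.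
Proof.
move=> bsO; apply/(@freeP _ _ _ (in_tuple bs)) => k k0 i.
have := congr1 (dot^~ bs`_i) k0; rewrite dot0l dot_suml (bigD1 i)//= dotZl.
rewrite bsO// eqxx mulr1 big1 ?addr0// => j ji.
by rewrite dotZl bsO// (_ : (j == i :> nat) = false) ?mulr0//; apply/negbTE.
Qed.

End Euclid.

(** An [n]-dimensional subspace is isometric to R^n, so its balls have the
    measure of those of R^n. *)
Lemma subspace_isometry {R : realType} {N : nat} (V : {vspace 'rV[R]_N}) :
  exists T : 'rV[R]_(\dim V) -> 'rV[R]_N, exists S,
  [/\ forall c d, enorm (T c - T d) = enorm (c - d),
   forall c, T c \in V, T 0 = 0 & {in V, cancel S T}].
Proof.
have [bs bsO bsE] := gram_schmidt (vbasis V).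
rewrite (span_basis (vbasisP V)) in bsE; subst V.
have sz : size bs = \dim <<bs>> by apply/esym/eqP; exact: dot_orthonormal_free.
exists (fun c => \sum_(i < \dim <<bs>>) c 0 i *: bs`_i).
exists (fun v => \row_(i < \dim <<bs>>) dot v bs`_i); split.
- move=> c d; rewrite -sumrB; under eq_bigr do rewrite -scalerBl.
  congr Num.sqrt; rewrite dot_suml; apply: eq_bigr => i _.
  rewrite dotZl dot_sumr (bigD1 i)//= dotZr bsO ?sz// eqxx mulr1.
  rewrite big1 ?addr0 ?mxE// => j ji.
  by rewrite dotZr bsO ?sz// eq_sym (_ : (j == i :> nat) = false) ?mulr0//;
    apply/negbTE.
- by move=> c; apply: memv_suml => i _; apply/memvZ/memv_span/mem_nth; rewrite sz.
- by apply: big1 => i _; rewrite mxE scale0r.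
- move=> v vb; rewrite [RHS](dot_orthonormal_coord bsO vb).
  rewrite /projection sz; by apply: eq_bigr => i _; rewrite mxE.
Qed.

(** * Hausdorff measure: Lipschitz images and measurable sets *)

Section ExpE.
Context {R : realType}.
Local Open Scope ereal_scope.
Implicit Types x y : \bar R.

Lemma lee_expe n x y : 0 <= x -> x <= y -> x ^+ n <= y ^+ n.
Proof.
move=> x0 xy; elim: n => [|n ih]; first by rewrite !expe0.
by rewrite !expeS lee_pmul// expe_ge0.
Qed.

Lemma expeMl n (r : R) x : (r%:E * x) ^+ n = (r ^+ n)%:E * x ^+ n.
Proof.
elim: n => [|n ih]; first by rewrite !expe0 expr0 mule1.
by rewrite !expeS ih exprS EFinM muleACA.
Qed.

End ExpE.

Section Gauge.
Context {R : realType}.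
Local Open Scope ereal_scope.

Lemma le_diam N (A B : set 'rV[R]_N) : A `<=` B -> diam A <= diam B.
Proof.
move=> AB; apply: le_ereal_sup => _ [[a b] [/= Aa Ab] <-].
by exists (a, b) => //; split => /=; exact: AB.
Qed.

Lemma enorm_le_diam N (A : set 'rV[R]_N) a b : A a -> A b ->
  (enorm (a - b))%:E <= diam A.
Proof. by move=> Aa Ab; apply: ereal_sup_ubound; exists (a, b). Qed.

Lemma diam_le N (A : set 'rV[R]_N) (d : \bar R) :
  (forall a b, A a -> A b -> (enorm (a - b))%:E <= d) -> diam A <= d.
Proof. by move=> h; apply: ge_ereal_sup => _ [[a b] [/= Aa Ab] <-]; exact: h. Qed.

Lemma le_hausdorff_gauge N n (A B : set 'rV[R]_N) : A `<=` B ->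
  hausdorff_gauge n A <= hausdorff_gauge n B.
Proof.
move=> AB; rewrite {1}/hausdorff_gauge.
have [_|A0] := eqVneq A set0; first exact: hausdorff_gauge_ge0.
rewrite /hausdorff_gauge ifF; last first.
  by apply/negbTE; apply: contra_neq A0 => B0; rewrite -subset0 -B0.
apply: lee_wpmul2l; first by rewrite lee_fin divr_ge0 ?ball_volume_ge0 ?exprn_ge0.
by apply: lee_expe; [exact: diam_ge0|exact: le_diam].
Qed.

Lemma hausdorff_gauge_image N M n (A : set 'rV[R]_N) (f : 'rV_N -> 'rV_M)
    (L : R) :
  (0 <= L)%R ->
  (forall a b, A a -> A b -> (enorm (f a - f b) <= L * enorm (a - b))%R) ->
  hausdorff_gauge n (f @` A) <= (L ^+ n)%:E * hausdorff_gauge n A.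
Proof.
move=> L0 fL; rewrite {1}/hausdorff_gauge.
case: ifPn => [_|fA0].
  by rewrite mule_ge0 ?hausdorff_gauge_ge0// lee_fin exprn_ge0.
rewrite /hausdorff_gauge ifF; last first.
  by apply/negbTE; apply: contra_neq fA0 => ->; exact: image_set0.
rewrite muleCA; apply: lee_wpmul2l.
  by rewrite lee_fin divr_ge0 ?ball_volume_ge0 ?exprn_ge0.
rewrite -expeMl; apply: lee_expe; first exact: diam_ge0.
apply: diam_le => _ _ [a Aa <-] [b Ab <-].
apply: (@le_trans _ _ (L%:E * (enorm (a - b))%:E)).
  by rewrite -EFinM lee_fin fL.
by apply: lee_wpmul2l => //; exact: enorm_le_diam.
Qed.

Lemma hausdorff_image N M n (A : set 'rV[R]_N) (f : 'rV_N -> 'rV_M) (L : R) :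
  (0 < L)%R ->
  (forall a b, A a -> A b -> (enorm (f a - f b) <= L * enorm (a - b))%R) ->
  hausdorff n (f @` A) <= (L ^+ n)%:E * hausdorff n A.
Proof.
move=> L0 fL; apply: ge_ereal_sup => _ [d d0 <-].
have dL0 : (0 < d / L)%R by rewrite divr_gt0.
apply: (@le_trans _ _ ((L ^+ n)%:E * hausdorff_size n (d / L) A)); last first.
  apply: lee_wpmul2l; first by rewrite lee_fin exprn_ge0// ltW.
  exact: hausdorff_size_le.
rewrite -lee_pdivrMl ?exprn_gt0//; apply: le_ereal_inf_tmp => _ [U [AU dU] <-].
rewrite lee_pdivrMl ?exprn_gt0//.
apply: (@le_trans _ _ (\sum_(k <oo) hausdorff_gauge n (f @` (A `&` U k)))).
  apply: ereal_inf_lbound; exists (fun k => f @` (A `&` U k)) => //; split.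
    by move=> _ [a Aa <-]; have [k _ Uka] := AU _ Aa; exists k => //; exists a.
  move=> k; apply: diam_le => _ _ [a [Aa Ua] <-] [b [Ab Ub] <-].
  rewrite lee_fin (le_trans (fL _ _ Aa Ab))// mulrC -ler_pdivlMr//.
  by rewrite -lee_fin (le_trans _ (dU k))// enorm_le_diam.
rewrite -nneseriesZl; last by move=> i _; exact: hausdorff_gauge_ge0.
apply: lee_nneseries => [k _ _|k _]; first exact: hausdorff_gauge_ge0.
apply: (@le_trans _ _ ((L ^+ n)%:E * hausdorff_gauge n (A `&` U k))).
  by apply: hausdorff_gauge_image; [exact: ltW|move=> a b [Aa _] [Ab _]; exact: fL].
apply: lee_wpmul2l; first by rewrite lee_fin exprn_ge0// ltW.
by apply: le_hausdorff_gauge => ? [].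
Qed.

(** The map need not be invertible on the whole space: any left inverse on [A]
    is an isometry on the image. *)
Lemma hausdorff_isometry N M n (A : set 'rV[R]_N) (f : 'rV_N -> 'rV_M) :
  (forall a b, A a -> A b -> enorm (f a - f b) = enorm (a - b)) ->
  hausdorff n (f @` A) = hausdorff n A.
Proof.
move=> fiso; apply/eqP; rewrite eq_le; apply/andP; split.
  rewrite -[leRHS]mul1e -(expr1n _ n); apply: hausdorff_image => // a b Aa Ab.
  by rewrite mul1r fiso.
have [g gf] : exists g : 'rV_M -> 'rV_N, forall a, A a -> g (f a) = a.
  have /choice[g gP] : forall b, exists a, (f @` A) b -> A a /\ f a = b.
    move=> b; have [[a Aa fa]|nb] := pselect ((f @` A) b); last by exists 0%R.
    by exists a => _.
  exists g => a Aa; have [|Aga fga] := gP (f a); first by exists a.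
  apply/eqP; rewrite -subr_eq0; apply/eqP/enorm_eq0.
  by rewrite -fiso// fga subrr enorm0.
have {1}-> : A = g @` (f @` A).
  apply/seteqP; split => [a Aa|_ [_ [a Aa <-] <-]]; last by rewrite gf.
  by exists (f a); [exists a|exact: gf].
rewrite -[leRHS]mul1e -(expr1n _ n); apply: hausdorff_image => //.
by move=> _ _ [a Aa <-] [b Ab <-]; rewrite !gf// mul1r fiso.
Qed.

Lemma hausdorff_scale N n (A : set 'rV[R]_N) (r : R) : (0 < r)%R ->
  hausdorff n ((fun z => r *: z)%R @` A) = (r ^+ n)%:E * hausdorff n A.
Proof.
move=> r0; apply/eqP; rewrite eq_le; apply/andP; split.
  by apply: hausdorff_image => // a b _ _; rewrite -scalerBr enormZ gtr0_norm.
have {1}-> : A = (fun z => r^-1 *: z)%R @` ((fun z => r *: z)%R @` A).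
  rewrite image_comp; apply/seteqP; split => [a Aa|_ [a Aa <-]] /=.
    by exists a => //=; rewrite scalerA mulVf ?gt_eqF// scale1r.
  by rewrite scalerA mulVf ?gt_eqF// scale1r.
rewrite -lee_pdivlMl ?exprn_gt0// -exprVn.
apply: hausdorff_image; first by rewrite invr_gt0.
by move=> a b _ _; rewrite -scalerBr enormZ gtr0_norm ?invr_gt0.
Qed.

End Gauge.

Section Caratheodory.
Context {R : realType} {N : nat}.
Implicit Types A B X : set 'rV[R]_N.
Local Open Scope ereal_scope.

(** A cover by sets of diameter less than [r] splits into a cover of [A] and a
    cover of [B], as no member meets both. *)
Lemma hausdorff_separated n A B (r : R) : (0 < r)%R ->
  (forall a b, A a -> B b -> (r <= enorm (a - b))%R) ->
  hausdorff n A + hausdorff n B <= hausdorff n (A `|` B).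
Proof.
move=> r0 AB.
have sizeU d : (0 < d < r)%R ->
    hausdorff_size n d A + hausdorff_size n d B <= hausdorff n (A `|` B).
  move=> /andP[d0 dr]; apply: le_trans (hausdorff_size_le n (A `|` B) d0).
  apply: le_ereal_inf_tmp => _ [U [ABU dU] <-].
  apply: (@le_trans _ _ (\sum_(k <oo) (hausdorff_gauge n (A `&` U k)
                        + hausdorff_gauge n (B `&` U k)))).
    rewrite nneseriesD//; [|by move=> *; exact: hausdorff_gauge_ge0..].
    apply: leeD; apply: ereal_inf_lbound.
    - exists (fun k => A `&` U k) => //; split => [a Aa|k].
        by have [|k _ Uk] := ABU a; [left|exists k].
      by apply: le_trans (dU k); apply: le_diam; exact: subIsetr.
    - exists (fun k => B `&` U k) => //; split => [a Ba|k].
        by have [|k _ Uk] := ABU a; [right|exists k].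
      by apply: le_trans (dU k); apply: le_diam; exact: subIsetr.
  apply: lee_nneseries => [k _ _|k _].
    by rewrite adde_ge0 ?hausdorff_gauge_ge0.
  have [->|/set0P[a [Aa Ua]]] := eqVneq (A `&` U k) set0.
    by rewrite hausdorff_gauge0 add0e le_hausdorff_gauge//; exact: subIsetr.
  rewrite (_ : B `&` U k = set0) ?hausdorff_gauge0 ?adde0.
    by rewrite le_hausdorff_gauge//; exact: subIsetr.
  rewrite -subset0 => b [Bb Ub].
  have := le_trans (enorm_le_diam Ua Ub) (dU k).
  by rewrite lee_fin leNgt (lt_le_trans dr)// AB.
have sizeS d e C : (d <= e)%R -> hausdorff_size n e C <= hausdorff_size n d C.
  move=> de; apply: le_ereal_inf => _ [U [CU dU] <-]; exists U => //; split => //.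
  by move=> k; rewrite (le_trans (dU k))// lee_fin.
have size_gt0 C d : hausdorff_size n d C != -oo.
  by rewrite gt_eqF// (lt_le_trans _ (hausdorff_size_ge0 _ _ _)).
have [Hoo|Hoo] := eqVneq (hausdorff n (A `|` B)) +oo; first by rewrite Hoo leey.
have Hlt : hausdorff n (A `|` B) < +oo by rewrite ltey.
have fin C : hausdorff n C <= hausdorff n (A `|` B) -> hausdorff n C \is a fin_num.
  by move=> h; rewrite ge0_fin_numE ?hausdorff_ge0// (le_lt_trans h).
have Afin : hausdorff n A \is a fin_num by apply/fin/le_hausdorff; exact: subsetUl.
rewrite addeC -leeBrDr//; apply: ge_ereal_sup => _ [e e0 <-].
have Bfin : hausdorff_size n e B \is a fin_num.
  rewrite ge0_fin_numE ?hausdorff_size_ge0// (le_lt_trans (hausdorff_size_le n B e0))//.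
  by rewrite (le_lt_trans _ Hlt)// le_hausdorff//; exact: subsetUr.
rewrite leeBrDr// addeC -leeBrDr//; apply: ge_ereal_sup => _ [d d0 <-].
rewrite leeBrDr//.
pose m := Num.min (Num.min d e) (r / 2)%R.
have mpos : (0 < m < r)%R.
  rewrite !lt_min d0 e0 divr_gt0//= !gt_min; apply/orP; right.
  by rewrite ltr_pdivrMr// ltr_pMr// ltr1n.
apply: le_trans (sizeU m mpos).
by apply: leeD; apply: sizeS; rewrite !ge_min lexx ?orbT.
Qed.

(** Caratheodory's criterion.  A test set [X] splits at positive distance along
    [c + r <= f] and [f <= c]; what is lost in between is a tail of the series
    of the measures of the slices [Z k], which converges because
    slices of the same parity are at positive distance from each other. *)
Lemma caratheodory_lipschitz n (f : 'rV[R]_N -> R) (c : R) :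
  (forall a b, f a - f b <= enorm (a - b))%R ->
  (hausdorff_outer R N n).-caratheodory [set z | (c < f z)%R].
Proof.
move=> f1; set E := [set z | _].
apply: le_caratheodory_measurable => X; change (hausdorff n (X `&` E)
  + hausdorff n (X `&` ~` E) <= hausdorff n X).
have [->|Xoo] := eqVneq (hausdorff n X) +oo; first by rewrite leey.
have Xlt : hausdorff n X < +oo by rewrite ltey.
pose r (k : nat) : R := (k.+1%:R^-1)%R.
have rS k : (r k.+1 < r k)%R by rewrite ltf_pV2 ?posrE// ltr_nat.
pose Y k := X `&` [set z | (c + r k <= f z)%R].
pose Z k := X `&` [set z | (c + r k.+1 <= f z < c + r k)%R].
have YX k : Y k `<=` X by move=> z [].
have YC k : hausdorff n (Y k) + hausdorff n (X `&` ~` E) <= hausdorff n X.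
  apply: (@le_trans _ _ (hausdorff n (Y k `|` (X `&` ~` E)))).
    apply: (@hausdorff_separated _ _ _ (r k)); first by rewrite invr_gt0.
    move=> a b [_ /= fa] [_ /negP]; rewrite -leNgt => fb.
    by rewrite (le_trans _ (f1 a b))//; lra.
  by apply: le_hausdorff => z [[]|[]].
have ZY k : hausdorff n (Y k) + hausdorff n (Z k.+1) <= hausdorff n (Y k.+2).
  apply: (@le_trans _ _ (hausdorff n (Y k `|` Z k.+1))).
    apply: (@hausdorff_separated _ _ _ (r k - r k.+1)%R); first by rewrite subr_gt0.
    move=> a b [_ /= fa] [_ /= /andP[_ fb]].
    by rewrite (le_trans _ (f1 a b))//; lra.
  apply: le_hausdorff => z [[Xz /= fz]|[Xz /= /andP[fz _]]]; split => //=.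
  by have := rS k; have := rS k.+1; lra.
(* The slice Z (k+1) and Y k are separated and lie in Y (k+2), so even and odd
   slices are counted by Y m and Y (m+1), one parity in each. *)
have sumZ m : \sum_(0 <= k < m) hausdorff n (Z k.+1) <=
    hausdorff n (Y m) + hausdorff n (Y m.+1).
  elim: m => [|m ih]; first by rewrite big_geq// adde_ge0 ?hausdorff_ge0.
  rewrite big_nat_recr//=; apply: le_trans (leeD2r _ ih) _.
  by rewrite addeAC addeC leeD2l.
have Zlt : \sum_(0 <= k <oo) hausdorff n (Z k.+1) < +oo.
  apply: (@le_lt_trans _ _ (hausdorff n X + hausdorff n X)); last first.
    by rewrite lte_add_pinfty.
  apply: lime_le; first by apply: is_cvg_nneseries => *; exact: hausdorff_ge0.
  by apply: nearW => m; rewrite (le_trans (sumZ m))// leeD// le_hausdorff.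
apply/lee_addgt0Pr => e e0.
have tl := nneseries_tail_cvg Zlt (fun k _ => hausdorff_ge0 n (Z k.+1)).
have [k _ /(_ k (leqnn k))/= tk] : \forall k \near \oo,
  \sum_(k <= j <oo) hausdorff n (Z j.+1) < e%:E.
  apply: (tl [set y | y < e%:E]); apply: open_nbhs_nbhs; split => /=.
    exact: open_ereal_lt_ereal.
  by rewrite lte_fin.
apply: (@le_trans _ _ (hausdorff n (Y k.+1) + e%:E + hausdorff n (X `&` ~` E))).
  apply: leeD2r; apply: (@le_trans _ _ (hausdorff n (Y k.+1) +
      hausdorff n (\bigcup_(j in ~` `I_k) Z j.+1))).
    apply: le_trans (outer_measureU2 (hausdorff_outer R N n) _ _).
    apply: le_hausdorff => z [Xz /= cz].
    have [cz'|cz'] := leP (c + r k.+1)%R (f z); first by left.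
    right.
    have exk : exists k0, (c + r k0 <= f z)%R.
      by have [k0 /ltW k0P] := ltr_add_invr cz; exists k0.
    have [j jP jmin] := ex_minnP exk.
    have kj : (k.+1 < j)%N.
      rewrite ltnNge; apply/negP => jk; move: cz'; apply/negP; rewrite -leNgt.
      by rewrite (le_trans _ jP)// lerD2l lef_pV2 ?posrE// ler_nat.
    move: j kj jP jmin => [|[|i]]// ki iP imin.
    exists i => /=; first by apply/negP; rewrite -leqNgt.
    split => //=; rewrite iP/= ltNge; apply/negP => /imin.
    by rewrite ltnn.
  by rewrite leeD2l// (le_trans (outer_measure_sigma_subadditive_tail _ _ _))// ltW.
by rewrite addeAC leeD2r.
Qed.

Lemma measurable_lipschitz n (f : hausdorff_mspace R N n -> R) :
  (forall a b : 'rV[R]_N, f a - f b <= enorm (a - b))%R ->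
  measurable_fun setT f.
Proof.
move=> f1; apply: (measurability _ (RGenOInfty.measurableE R)) => //.
move=> _ [_ [c ->] <-]; rewrite setTI.
rewrite (_ : _ @^-1` _ = [set z | (c < f z)%R]).
  exact: caratheodory_lipschitz.
by apply/seteqP; split => z /=; rewrite in_itv/= andbT.
Qed.

End Caratheodory.

(** * The cube has finite measure *)

Section Finite.
Context {R : realType}.

Lemma hausdorff_gauge_le N n (A : set 'rV[R]_N) (d : R) : 0 <= d ->
  (forall a b, A a -> A b -> enorm (a - b) <= d) ->
  (hausdorff_gauge n A <= (ball_volume n / 2 ^+ n * d ^+ n)%:E)%E.
Proof.
move=> d0 Ad; rewrite /hausdorff_gauge; case: ifPn => [_|A0].
  by rewrite lee_fin mulr_ge0 ?exprn_ge0// divr_ge0 ?ball_volume_ge0 ?exprn_ge0.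
rewrite [in leRHS]EFinM EFin_expe; apply: lee_wpmul2l.
  by rewrite lee_fin divr_ge0 ?ball_volume_ge0 ?exprn_ge0.
by apply: lee_expe; [exact: diam_ge0|apply: diam_le => a b Aa Ab; rewrite lee_fin Ad].
Qed.

(** The [m^n] cubes of side [2/m] that fill the cube have a total gauge
    independent of [m]. *)
Lemma hausdorff_cube_lty n :
  (hausdorff n [set z : 'rV[R]_n | forall i, (`|z 0 i| <= 1)%R]%R < +oo)%E.
Proof.
set Q := [set z | _].
suff h : (hausdorff n Q <=
    (ball_volume n / 2 ^+ n * (n%:R * 2) ^+ n)%:E)%E.
  by rewrite (le_lt_trans h)// ltry.
apply: ge_ereal_sup => _ [d /= d0 <-].
have [m [mpos md]] : exists m, (0 < m)%N /\ n%:R * (2 / m%:R) <= d.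
  exists (Num.truncn (n%:R * 2 / d)).+1; split => //.
  by rewrite mulrA ler_pdivrMr// -ler_pdivrMl// mulrC ltW// truncnS_gt.
have m0 : 0 < m%:R :> R by rewrite ltr0n.
pose cube (f : {ffun 'I_n -> 'I_m}) := [set z : 'rV[R]_n |
  forall i, -1 + 2 / m%:R * (f i)%:R <= z 0 i <= -1 + 2 / m%:R * (f i).+1%:R].
have cubed f a b : cube f a -> cube f b -> enorm (a - b) <= n%:R * (2 / m%:R).
  move=> ca cb; apply: enorm_le_coord; first by rewrite divr_ge0.
  move=> i; have := ca i; have := cb i.
  rewrite !mxE -[(f i).+1%:R]natr1 mulrDr mulr1 ler_norml; lra.
pose s := [seq cube f | f <- enum {: {ffun 'I_n -> 'I_m}}].
have szs : size s = (m ^ n)%N by rewrite size_map -cardE card_ffun !card_ord.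
apply: (@le_trans _ _ (\sum_(k <oo) hausdorff_gauge n (nth set0 s k))%E).
  apply: ereal_inf_lbound; exists (nth set0 s) => //; split.
    move=> z Qz.
    (* The minimum matters on the far faces, where the coordinate is 1. *)
    have fP i : (minn (Num.truncn ((z 0 i + 1) * m%:R / 2)%R) m.-1 < m)%N.
      by rewrite gtn_min ltn_predL mpos orbT.
    pose f := [ffun i => Ordinal (fP i)].
    exists (index f (enum {: {ffun 'I_n -> 'I_m}})) => //.
    rewrite (nth_map f) ?index_mem ?mem_enum// nth_index ?mem_enum//.
    move=> i; rewrite ffunE /=.
    set w := (z 0 i + 1) * m%:R / 2.
    have zE : z 0 i = -1 + 2 / m%:R * w by rewrite /w; field; rewrite gt_eqF.
    have /andP[w0 wm] : 0 <= w <= m%:R.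
      have := Qz i; rewrite ler_norml => /andP[z1 z2]; apply/andP; split.
        by rewrite divr_ge0// mulr_ge0//; lra.
      rewrite ler_pdivrMr// mulrC ler_wpM2l//; lra.
    have /andP[tw wt] := truncn_itv w0.
    rewrite zE !lerD2l !ler_pM2l ?divr_gt0//; apply/andP; split.
      by rewrite (le_trans _ tw)// ler_nat geq_minl.
    have [tm|tm] := leqP (Num.truncn w) m.-1; first exact: ltW.
    by rewrite prednK.
  move=> k; have [ks|ks] := ltnP k (size s); last first.
    by rewrite nth_default//; apply: diam_le.
  have /mapP[f _ ->] := mem_nth set0 ks.
  by apply: diam_le => a b ca cb; rewrite lee_fin (le_trans (cubed _ _ _ ca cb)).
rewrite (nneseries_split 0 (size s)); last by move=> *; exact: hausdorff_gauge_ge0.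
rewrite add0n [X in (_ + X)%E]eseries0 ?adde0; last first.
  by move=> k sk _; rewrite nth_default// hausdorff_gauge0.
apply: (@le_trans _ _ (\sum_(0 <= k < size s)
   (ball_volume n / 2 ^+ n * (n%:R * (2 / m%:R)) ^+ n)%:E)%E).
  rewrite big_nat [leRHS]big_nat; apply: lee_sum => k /andP[_ ks].
  apply: hausdorff_gauge_le; first by rewrite mulr_ge0// divr_ge0.
  by have /mapP[f _ ->] := mem_nth set0 ks; exact: cubed.
rewrite sumEFin lee_fin sumr_const_nat subn0 szs -[leLHS]mulr_natl natrX.
rewrite !exprMn exprVn le_eqVlt; apply/orP; left; apply/eqP; field.
by rewrite ?pnatr_eq0 ?expf_neq0 ?gt_eqF.
Qed.

End Finite.

(** * The cube has positive measure *)

Section Positive.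
Context {R : realType}.

Lemma card_close_ord m (c r : R) : 0 <= r ->
  #|[pred j : 'I_m | `|j%:R - c| < r]|%:R <= 2 * r + 1.
Proof.
move=> r0; set A := [pred j | _].
have [a Aa|A0] := pickP A; last by rewrite (eq_card0 A0) addr_ge0// mulr_ge0.
case: (@arg_minnP _ a A (fun j => j : nat) Aa) => j0 Aj0 minj0.
case: (@arg_maxnP _ a A (fun j => j : nat) Aa) => j1 Aj1 maxj1.
have : (#|A| <= (j1 - j0).+1)%N.
  rewrite -(size_iota j0 (j1 - j0).+1) cardE -(size_map val).
  apply: uniq_leq_size; first by rewrite map_inj_uniq ?enum_uniq//; exact: val_inj.
  move=> _ /mapP[j + ->]; rewrite mem_enum => Aj.
  have j1j : (j <= j1)%N := maxj1 _ Aj.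
  by rewrite mem_iota minj0//= addnS ltnS subnKC// (leq_trans _ j1j)// minj0.
rewrite -(ler_nat R) => /le_trans; apply.
rewrite -natr1 natrB ?lerD2r; last exact: minj0.
by move: Aj0 Aj1; rewrite /A/= !ltr_norml; lra.
Qed.

(** A volume estimate obtained by counting the [m^N] points of a fine grid: a box
    of side [2 r] contains at most [(2 m r + 1)^N] of them, and
    [2 m r + 1 <= 3 m r] once [m r >= 1]. *)
Lemma unit_cube_cover N (s : seq ('rV[R]_N * R)) :
  (forall p, p \in s -> 0 < p.2) ->
  (forall z : 'rV[R]_N, (forall i, 0 <= z 0 i <= 1) ->
     exists2 p, p \in s & forall i, `|z 0 i - p.1 0 i| < p.2) ->
  1 <= \sum_(p <- s) (3 * p.2) ^+ N.
Proof.
move=> s0 scov.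
have [m [m0 ms]] : exists m, (0 < m)%N /\ forall p, p \in s -> 1 <= m%:R * p.2.
  elim: s s0 {scov} => [_|p s ih ps0]; first by exists 1.
  have [|m [m0 ms]] := ih; first by move=> q qs; rewrite ps0// inE qs orbT.
  exists (m + (Num.truncn p.2^-1).+1)%N; split; first by rewrite addnS.
  have p0 : 0 < p.2 by rewrite ps0// inE eqxx.
  move=> q; rewrite inE natrD mulrDl => /orP[/eqP->|qs].
    rewrite -[leLHS]add0r lerD ?mulr_ge0 ?(ltW p0)//.
    by rewrite -ler_pdivrMr// div1r ltW// truncnS_gt// invr_ge0 ltW.
  by rewrite -[leLHS]addr0 lerD ?ms// mulr_ge0 ?(ltW (ps0 _ _))// inE qs orbT.
have mpos : 0 < m%:R :> R by rewrite ltr0n.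
pose close (p : 'rV[R]_N * R) i := [pred j : 'I_m | `|j%:R - m%:R * p.1 0 i| < m%:R * p.2].
pose B p := [pred f : {ffun 'I_N -> 'I_m} | [forall i, close p i (f i)]].
have cardB p : p \in s -> #|B p|%:R <= (3 * m%:R * p.2) ^+ N.
  move=> ps; rewrite (_ : #|B p| = #|family (close p)|); last first.
    by apply: eq_card => f; rewrite !inE.
  rewrite card_family foldrE big_map natr_prod.
  rewrite -[leRHS](_ : \prod_(i : 'I_N) (3 * m%:R * p.2) = _); last first.
    by rewrite prodr_const card_ord.
  rewrite big_enum /=; apply: ler_prod => i _; rewrite ler0n/=.
  have mp := ms _ ps.
  apply: le_trans (card_close_ord _ _ _) _; first exact: le_trans mp.
  lra.
have count : (m ^ N <= \sum_(p <- s) #|B p|)%N.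
  have -> : (m ^ N = \sum_(f : {ffun 'I_N -> 'I_m}) 1)%N.
    by rewrite sum1_card card_ffun !card_ord.
  under [leqRHS]eq_bigr do rewrite -sum1_card big_mkcond.
  rewrite exchange_big /=; apply: leq_sum => f _.
  have [|p ps fp] := scov (\row_i ((f i)%:R / m%:R)).
    by move=> i; rewrite mxE divr_ge0//= ler_pdivrMr// mul1r ler_nat ltnW.
  rewrite (big_rem p)//= inE ifT// (_ : [forall i, _])//.
  apply/forallP => i; rewrite /close/=.
  have := fp i; rewrite mxE -(ltr_pM2l mpos) => h; apply: le_lt_trans h.
  rewrite -{2}(gtr0_norm mpos) -normrM le_eqVlt; apply/orP; left; apply/eqP.
  congr `|_|; field; by rewrite gt_eqF.
rewrite -(@ler_pM2l _ (m%:R ^+ N)) ?exprn_gt0// mulr1 -natrX.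
apply: (@le_trans _ _ (\sum_(p <- s) #|B p|)%:R); first by rewrite ler_nat.
rewrite natr_sum natrX mulr_sumr big_seq [leRHS]big_seq.
apply: ler_sum => p ps; apply: le_trans (cardB p ps) _.
by rewrite -exprMn mulrA (mulrC m%:R).
Qed.

Lemma ball_volume_gt0 n : 0 < ball_volume n :> R.
Proof.
suff : 0 < ball_volume n :> R /\ 0 < ball_volume n.+1 :> R by case.
elim: n => [|n [h1 h2]]; first by split => /=.
by split => //=; rewrite mulr_gt0// divr_gt0// mulr_gt0// pi_gt0.
Qed.

(** A cover of small total gauge could be enlarged slightly to a cover by open
    boxes; compactness would make it finite, against the volume estimate. *)
Lemma hausdorff_cube_gt0 N : (0 < N)%N ->
  (0 < hausdorff N [set z : 'rV[R]_N | forall i, (0 <= z 0 i <= 1)%R]%R)%E.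
Proof.
move=> N0; set Q := [set z | _].
pose c : R := ball_volume N / 2 ^+ N / (6 ^+ N * 2).
have c0 : 0 < c.
  apply: divr_gt0; [apply: divr_gt0 | apply: mulr_gt0];
    by rewrite ?ball_volume_gt0 ?exprn_gt0.
apply: (@lt_le_trans _ _ c%:E); first by rewrite lte_fin.
apply: le_trans (hausdorff_size_le N Q ltr01).
apply: le_ereal_inf_tmp => _ [U [QU dU] <-].
pose e k : R := 2 ^- k.+2 / 6.
have e0 k : 0 < e k by rewrite divr_gt0// invr_gt0 exprn_gt0.
have t01 k : 0 <= (2 : R) ^- k.+2 <= 1.
  by rewrite invr_ge0 exprn_ge0//= invf_le1 ?exprn_gt0// exprn_ege1// ler1n.
(* The k-th box has half-side d + e k, where d is the diameter of U k.  As
   (3 (d + e k))^N <= (6 d)^N + (6 e k)^N and 6 e k = 2^-(k+2), the terms e k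
   cost at most 1/2 in total. *)
have /choice[b bP] : forall k, exists b : 'rV[R]_N * R, 0 < b.2 /\
    (forall z, U k z -> forall i, `|z 0 i - b.1 0 i| < b.2) /\
    ((((3 * b.2) ^+ N)%:E <= (6 ^+ N / (ball_volume N / 2 ^+ N))%:E
       * hausdorff_gauge N (U k) + (2 ^- k.+2)%:E)%E).
  move=> k; have [Uk0|/set0P[a Ua]] := eqVneq (U k) set0.
    exists (0, e k); split => //=; rewrite Uk0; split => //.
    rewrite hausdorff_gauge0 mule0 add0e lee_fin.
    have /andP[t0 t1] := t01 k.
    apply: (@le_trans _ _ (3 * e k)); last by rewrite /e; lra.
    by rewrite ler_iXnr// /e; lra.
  have dfin : diam (U k) \is a fin_num.
    rewrite ge0_fin_numE ?diam_ge0//; last by apply/set0P; exists a.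
    by rewrite (le_lt_trans (dU k))// ltry.
  have d0 : 0 <= fine (diam (U k)) by rewrite fine_ge0// diam_ge0//; apply/set0P; exists a.
  exists (a, fine (diam (U k)) + e k); split; first by rewrite ltr_wpDl.
  split => [z Uz i|].
    have := coord_le_enorm (z - a) i; rewrite !mxE => /le_lt_trans; apply.
    rewrite (@le_lt_trans _ _ (fine (diam (U k))))// ?ltrDl//.
    by rewrite -lee_fin fineK// enorm_le_diam.
  rewrite /hausdorff_gauge ifF; last by apply/negbTE/set0P; exists a.
  rewrite -[diam (U k)]fineK// -EFin_expe -!EFinM -EFinD lee_fin/=.
  set d := fine _ in d0 *.
  rewrite mulrA divfK ?gt_eqF ?divr_gt0 ?exprn_gt0 ?ball_volume_gt0//.
  have /andP[t0 t1] := t01 k.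
  have e6 : 6 * e k = 2 ^- k.+2 by rewrite /e mulrC divfK.
  have le_t : (6 * e k) ^+ N <= 2 ^- k.+2 by rewrite e6 ler_iXnr.
  apply: le_trans (lerD (lexx _) le_t); rewrite -exprMn.
  have [de|ed] := leP d (e k).
    apply: ler_wpDl; first by rewrite exprn_ge0// mulr_ge0.
    rewrite lerXn2r ?nnegrE; have := e0 k; lra.
  apply: ler_wpDr; first by rewrite exprn_ge0// mulr_ge0// ltW.
  by rewrite lerXn2r ?nnegrE; have := e0 k; lra.
pose f k : set 'rV[R]_N := ball (b k).1 (b k).2.
have Qcpt : compact Q.
  have := @rV_compact R N (fun=> `[0, 1]%classic) (fun=> @segment_compact R 0 1).
  rewrite (_ : [set v | _] = Q)//; apply/seteqP; split => z /= zi i;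
    by have := zi i; rewrite in_itv.
have [D _ QD] : finite_subset_cover setT f Q.
  rewrite compact_cover in Qcpt; apply: Qcpt.
    by move=> k _; exact: ball_open.
  move=> z Qz; have [k _ Ukz] := QU _ Qz; exists k => //.
  split=> [|i j]; first exact: (bP k).1.
  by rewrite (ord1 i) /ball/= distrC; exact: (bP k).2.1.
have [n Dn] : exists n, forall k, k \in D -> (k < n)%N.
  exists (\sum_(k <- enum_fset D) k).+1 => k kD.
  by rewrite ltnS (big_rem k)//= leq_addr.
have /= := @unit_cube_cover N [seq b k | k <- index_iota 0 n] _ _.
rewrite big_map => /(_ _ _)/wrap[].
- by move=> _ /mapP[k _ ->]; exact: (bP k).1.
- move=> z /QD[k kD [_ zk]]; exists (b k).
    by apply/mapP; exists k => //; rewrite mem_index_iota Dn.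
  by move=> i; rewrite distrC; exact: zk.
move=> cov.
have sumt : (\sum_(0 <= k < n) 2 ^- k.+2 <= 2^-1 :> R).
  suff -> : (\sum_(0 <= k < n) 2 ^- k.+2 = 2^-1 - 2 ^- n.+1 :> R).
    by rewrite gerBl invr_ge0 exprn_ge0.
  elim: n {Dn cov} => [|n ih]; first by rewrite big_geq// expr1 subrr.
  rewrite big_nat_recr//= ih !exprS; field; by rewrite expf_neq0.
have : (1%:E <= (6 ^+ N / (ball_volume N / 2 ^+ N))%:E *
    (\sum_(k <oo) hausdorff_gauge N (U k)) + (2^-1)%:E :> \bar R)%E.
  apply: (@le_trans _ _ (\sum_(0 <= k < n) ((3 * (b k).2) ^+ N)%:E)%E).
    by rewrite sumEFin lee_fin.
  apply: (@le_trans _ _ (\sum_(0 <= k < n) ((6 ^+ N / (ball_volume N / 2 ^+ N))%:E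
       * hausdorff_gauge N (U k) + (2 ^- k.+2)%:E))%E).
    by apply: lee_sum => k _; exact: (bP k).2.2.
  rewrite big_split/= sumEFin leeD ?lee_fin//.
  rewrite -ge0_sume_distrr; last by move=> *; exact: hausdorff_gauge_ge0.
  apply: lee_wpmul2l.
    by rewrite lee_fin divr_ge0 ?exprn_ge0 ?divr_ge0 ?exprn_ge0// ltW// ball_volume_gt0.
  by apply: nneseries_lim_ge => k _ _; exact: hausdorff_gauge_ge0.
rewrite -leeBlDr// -EFinB -lee_pdivrMl; last first.
  by apply: divr_gt0; [|apply: divr_gt0]; rewrite ?ball_volume_gt0 ?exprn_gt0.
apply: le_trans; rewrite -EFinM lee_fin /c le_eqVlt; apply/orP; left; apply/eqP.
have bv := ball_volume_gt0 N; field.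
by rewrite ?expf_neq0// ?gt_eqF.
Qed.

End Positive.

(** * Balls and shells in a subspace *)

(** The distance to [V], as the length of the component orthogonal to [V]; it
    makes [V] a sublevel set of a Lipschitz function, hence measurable. *)
Lemma lipschitz_defect {R : realType} {N} (V : {vspace 'rV[R]_N}) :
  exists2 d : 'rV[R]_N -> R, forall a b, d a - d b <= enorm (a - b) &
    forall z, z \in V = (d z <= 0).
Proof.
have [bs bsO bsE] := gram_schmidt (vbasis V).
rewrite (span_basis (vbasisP V)) in bsE; subst V.
pose p := projection bs.
have pB a b : p (a - b) = p a - p b.
  by rewrite -sumrB; apply: eq_bigr => i _; rewrite dotDl dotNl scalerBl.
have qb z i : (i < size bs)%N -> dot (z - p z) bs`_i = 0.
  exact: projection_defect.
have qle z : enorm (z - p z) <= enorm z.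
  rewrite -(@ler_pXn2r _ 2)// ?nnegrE ?enorm_ge0// !enorm_sqr.
  have qp : dot (z - p z) (p z) = 0.
    by rewrite {2}/p /projection dot_sumr big1// => i _; rewrite dotZr qb// mulr0.
  have pyth (q w : 'rV[R]_N) : dot q w = 0 -> dot q q <= dot (q + w) (q + w).
    move=> qw; rewrite dotDl !dotDr (dotC w) qw addr0 add0r.
    by rewrite lerDl dot_ge0.
  by have := pyth _ _ qp; rewrite subrK.
exists (fun z => enorm (z - p z)) => [a b|z].
  rewrite (le_trans (enormB_le _ _))// (_ : _ - _ = a - b - p (a - b)) ?qle//.
  by rewrite pB; apply/rowP => i; rewrite !mxE; ring.
apply/idP/idP => [zV|].
  by rewrite /p -(dot_orthonormal_coord bsO zV) subrr enorm0.
move=> q0; have h : z - p z = 0.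
  by apply: enorm_eq0; apply/eqP; rewrite eq_le q0 enorm_ge0.
by rewrite -(subrK (p z) z) h add0r; exact: projection_span.
Qed.

Section Measurable.
Context {R : realType} {N : nat}.
Implicit Type V : {vspace 'rV[R]_N}.

Lemma measurable_subspace n V :
  measurable ([set z | z \in V] : set (hausdorff_mspace R N n)).
Proof.
have [d d1 dV] := lipschitz_defect V.
rewrite (_ : [set z | _] = ~` [set z | 0 < d z]).
  by apply: measurableC; exact: caratheodory_lipschitz.
apply/seteqP; split => z /=; rewrite dV leNgt => /negP//.
Qed.

Lemma measurable_enorm n (x : 'rV[R]_N) :
  measurable_fun setT (fun z : hausdorff_mspace R N n => enorm (x + z)).
Proof.
apply: measurable_lipschitz => a b.
by rewrite (le_trans (enormB_le _ _))// opprD addrACA subrr add0r.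
Qed.

Lemma measurable_enorm_gt n (r : R) :
  measurable ([set z | r < enorm z] : set (hausdorff_mspace R N n)).
Proof. by apply: caratheodory_lipschitz => a b; exact: enormB_le. Qed.

Lemma measurable_enorm_le n (r : R) :
  measurable ([set z | enorm z <= r] : set (hausdorff_mspace R N n)).
Proof.
rewrite (_ : [set z | _] = ~` [set z | r < enorm z]).
  by apply: measurableC; exact: measurable_enorm_gt.
by apply/seteqP; split => z /=; rewrite leNgt => /negP.
Qed.

End Measurable.

Section Ball.
Context {R : realType}.

Definition unit_ball_measure n : R :=
  fine (hausdorff n [set z : 'rV[R]_n | enorm z <= 1]).

Let unit_ball_lty n : (hausdorff n [set z : 'rV[R]_n | (enorm z <= 1)%R] < +oo)%E.
Proof.
apply: le_lt_trans (hausdorff_cube_lty n); apply: le_hausdorff => z /= z1 i.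
exact: le_trans (coord_le_enorm z i) z1.
Qed.

Lemma unit_ball_measureE n :
  (hausdorff n [set z : 'rV[R]_n | (enorm z <= 1)%R] = (unit_ball_measure n)%:E)%E.
Proof. by rewrite /unit_ball_measure fineK// ge0_fin_numE ?hausdorff_ge0. Qed.

Lemma unit_ball_measure_gt0 n : (0 < n)%N -> 0 < unit_ball_measure n.
Proof.
move=> n0; rewrite -lte_fin -unit_ball_measureE.
have n0R : 0 < n%:R^-1 :> R by rewrite invr_gt0 ltr0n.
have := hausdorff_cube_gt0 (R := R) n0.
rewrite -(@pmule_rgt0 _ (n%:R^-1 ^+ n)%:E) ?lte_fin ?exprn_gt0//.
rewrite -hausdorff_scale// => /lt_le_trans; apply; apply: le_hausdorff.
move=> _ [z zQ <-] /=; rewrite enormZ gtr0_norm// ler_pdivrMl ?ltr0n// mulr1.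
rewrite -[leRHS]mulr1; apply: enorm_le_coord => // i.
by have /andP[z0 z1] := zQ i; rewrite ger0_norm.
Qed.

Lemma hausdorff_subspace_ball N (V : {vspace 'rV[R]_N}) r : 0 < r ->
  (hausdorff (\dim V) [set z | z \in V /\ (enorm z <= r)%R] =
    (r ^+ \dim V * unit_ball_measure (\dim V))%:E)%E.
Proof.
move=> r0; rewrite EFinM -unit_ball_measureE -hausdorff_scale//.
have [T [S [Tiso TV T0 SK]]] := subspace_isometry V.
have Tn c : enorm (T c) = enorm c by rewrite -[T c]subr0 -T0 Tiso subr0.
rewrite -[RHS](@hausdorff_isometry _ _ _ _ _ T)//; congr hausdorff.
rewrite image_comp; apply/seteqP; split => [z /= [zV zr]|_ [c /= c1 <-]].
  exists (r^-1 *: S z); last by rewrite /= scalerA divff ?gt_eqF// scale1r SK.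
  rewrite /= enormZ gtr0_norm ?invr_gt0// ler_pdivrMl// mulr1.
  by rewrite -Tn SK.
split; first exact: TV.
by rewrite Tn enormZ gtr0_norm// -[leRHS]mulr1 ler_pM2l.
Qed.

Definition shell N (V : {vspace 'rV[R]_N}) a b : set 'rV[R]_N :=
  [set z | z \in V /\ a < enorm z <= b].

Lemma measurable_shell N (V : {vspace 'rV[R]_N}) n a b :
  measurable (shell V a b : set (hausdorff_mspace R N n)).
Proof.
rewrite (_ : shell V a b = [set z | z \in V] `&` [set z | a < enorm z]
    `&` [set z | enorm z <= b]).
  apply: measurableI; last exact: measurable_enorm_le.
  by apply: measurableI; [exact: measurable_subspace|exact: measurable_enorm_gt].
by apply/seteqP; split => z /=; [move=> [? /andP[]]|move=> [[zV az] zb]]; split => //; rewrite ?az.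
Qed.

Lemma hausdorff_shell N (V : {vspace 'rV[R]_N}) a b : 0 < a <= b ->
  (hausdorff_measure R N (\dim V) (shell V a b) =
    ((b ^+ \dim V - a ^+ \dim V) * unit_ball_measure (\dim V))%:E)%E.
Proof.
move=> /andP[a0 ab].
pose B r : set (hausdorff_mspace R N (\dim V)) := [set z | z \in V /\ enorm z <= r].
have mB r : measurable (B r).
  rewrite (_ : B r = [set z | z \in V] `&` [set z | enorm z <= r]) //.
  by apply: measurableI; [exact: measurable_subspace|exact: measurable_enorm_le].
have BE r : 0 < r -> (hausdorff_measure R N (\dim V) (B r) =
    (r ^+ \dim V * unit_ball_measure (\dim V))%:E)%E.
  exact: hausdorff_subspace_ball.
have b0 := lt_le_trans a0 ab.
rewrite (_ : shell V a b = B b `\` B a); last first.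
  apply/seteqP; split => z /=; rewrite /shell/=.
    by move=> [zV /andP[az zb]]; split => // -[_]; rewrite leNgt az.
  by move=> [[zV ->] /not_andP[//|/negP]]; rewrite -ltNge => ->.
have BI : B b `&` B a = B a.
  apply/seteqP; split => z /= [] //.
  by move=> zV za; split => //; split => //; exact: le_trans ab.
transitivity (hausdorff_measure R N (\dim V) (B b) -
              hausdorff_measure R N (\dim V) (B a))%E; last first.
  by rewrite !BE// -EFinB mulrBl.
rewrite -[in RHS]BI; apply: measureD => //.
by rewrite [X in (X < _)%E](BE b b0) ltry.
Qed.

End Ball.

(** * Radial integrals in different dimensions *)

Section Exterior.
Context {R : realType}.

Definition exterior N (V : {vspace 'rV[R]_N}) e : set 'rV[R]_N :=
  [set z | z \in V /\ e < enorm z].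

Lemma measurable_exterior N (V : {vspace 'rV[R]_N}) n e :
  measurable (exterior V e : set (hausdorff_mspace R N n)).
Proof.
rewrite (_ : exterior V e = [set z | z \in V] `&` [set z | e < enorm z])//.
by apply: measurableI; [exact: measurable_subspace|exact: measurable_enorm_gt].
Qed.

Lemma expr_unbounded (x M : R) : 1 < x -> exists j, M <= x ^+ j.
Proof.
move=> x1; have bern j : 1 + j%:R * (x - 1) <= x ^+ j.
  elim: j => [|j ih]; first by rewrite mul0r addr0.
  have x0 : 0 <= x by lra.
  rewrite exprS (le_trans _ (ler_wpM2l x0 ih))// -natr1.
  have : 0 <= j%:R * (x - 1) ^+ 2 by rewrite mulr_ge0// sqr_ge0.
  rewrite expr2; lra.
have x10 : 0 < x - 1 by rewrite subr_gt0.
exists (Num.truncn (M / (x - 1))).+1; apply: le_trans (bern _).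
rewrite ler_wpDl// -ler_pdivrMr// ltW// truncnS_gt//.
Qed.

Variables (N : nat) (V : {vspace 'rV[R]_N}) (e x : R).
Hypotheses (e0 : 0 < e) (x1 : 1 < x).
Let ring j := shell V (e * x ^+ j) (e * x ^+ j.+1).

Let ring_gt0 j : 0 < e * x ^+ j.
Proof. by rewrite mulr_gt0// exprn_gt0// (lt_trans _ x1). Qed.

Let ring_le i j : (i <= j)%N -> e * x ^+ i <= e * x ^+ j.
Proof. by move=> ij; rewrite ler_pM2l// ler_weXn2l// ltW. Qed.

Lemma exterior_rings : exterior V e = \bigcup_j ring j.
Proof.
apply/seteqP; split => [z [zV ez]|z [j _ [zV /andP[jz _]]]]; last first.
  split => //; apply: le_lt_trans jz.
  by have := ring_le (leq0n j); rewrite expr0 mulr1.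
have ex : exists j, enorm z <= e * x ^+ j.+1.
  have [j jP] := expr_unbounded (enorm z / e) x1; exists j.
  apply: le_trans (ring_le (leqnSn j)).
  by rewrite -ler_pdivrMl// mulrC.
have [j jP jmin] := ex_minnP ex; exists j => //; split => //; rewrite jP andbT.
case: j jP jmin => [|j] jP jmin; first by rewrite expr0 mulr1.
by rewrite ltNge; apply/negP => /jmin; rewrite ltnn.
Qed.

Lemma trivIset_rings : trivIset setT ring.
Proof.
have disj i j : (i < j)%N -> ring i `&` ring j = set0.
  move=> ij; rewrite -subset0 => z [[_ /andP[_ zi]] [_ /andP[jz _]]].
  by have := lt_le_trans jz (le_trans zi (ring_le ij)); rewrite ltxx.
apply/trivIsetP => i j _ _; rewrite neq_ltn => /orP[|] ij; first exact: disj.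
by rewrite setIC disj.
Qed.

End Exterior.

Lemma powR_gt1 {R : realType} (a p : R) : 1 < a -> 0 < p -> 1 < a `^ p.
Proof.
move=> a1 p0; rewrite -[ltLHS](_ : 1 `^ p = 1); last by rewrite powR1.
by apply: gt0_ltr_powR; rewrite ?nnegrE// ltW// (lt_trans _ a1).
Qed.

Section Radial.
Context {R : realType} {N : nat}.
Variables (s : R) (psi : R -> R).
Hypotheses (s0 : 0 < s) (psi0 : forall r, 0 <= psi r)
  (psiM : {homo psi : a b / a <= b}).
Implicit Type V : {vspace 'rV[R]_N}.

(** In dimension [n] the weight [|z|^-(n + 2s)] turns [psi |z|] into an integral
    that is, up to a constant, that of [psi r * r^-(2s)] against [dr / r]. *)
Definition radial n (z : 'rV[R]_N) : \bar R :=
  (psi (enorm z) / enorm z `^ (n%:R + 2 * s))%:E.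

Lemma radial_ge0 n z : (0 <= radial n z)%E.
Proof. by rewrite lee_fin divr_ge0// powR_ge0. Qed.

Lemma measurable_radial n m (D : set (hausdorff_mspace R N m)) :
  measurable_fun D (radial n : hausdorff_mspace R N m -> \bar R).
Proof.
apply/measurable_EFinP; apply: measurable_funTS.
have me : measurable_fun setT (fun z : hausdorff_mspace R N m => enorm z).
  by apply: measurable_lipschitz => a b; exact: enormB_le.
under eq_fun do rewrite -powRN.
apply: measurable_funM.
  have mpsi : measurable_fun setT psi by exact: nondecreasing_measurable.
  exact: measurableT_comp mpsi me.
exact: measurableT_comp (measurable_powR _) me.
Qed.

(* The density of the radial integral against dr / r. *)
Let tau r := psi r * r `^ (- (2 * s)).

Let tau_ge0 r : 0 <= tau r.
Proof. by rewrite mulr_ge0// powR_ge0. Qed.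

Section Shell.
Variables (V : {vspace 'rV[R]_N}) (a x : R).
Hypotheses (a0 : 0 < a) (x1 : 1 < x).
Let n := \dim V.
Let w := unit_ball_measure (R := R) n.

Let x0 : 0 < x. Proof. exact: lt_trans x1. Qed.
Let aax : a < a * x. Proof. by rewrite ltr_pMr. Qed.
Let ax0 : 0 < a * x. Proof. exact: lt_trans aax. Qed.

Let int_cst (c : R) :
  (\int[hausdorff_measure R N n]_(z in shell V a (a * x)%R) c%:E =
  (c * (a ^+ n * (x ^+ n - 1) * w))%R%:E)%E.
Proof.
rewrite integral_cst; last exact: measurable_shell.
rewrite [X in (_ * X)%E]hausdorff_shell ?a0 ?ltW//.
by rewrite -EFinM exprMn mulrBr mulr1.
Qed.

Lemma radial_shell_le :
  (\int[hausdorff_measure R N n]_(z in shell V a (a * x)%R) radial n z <=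
  (w * (x ^+ n - 1) * x `^ (2 * s) * tau (a * x))%R%:E)%E.
Proof.
apply: (@le_trans _ _ (\int[hausdorff_measure R N n]_(z in shell V a (a * x)%R)
    (psi (a * x) / a `^ (n%:R + 2 * s))%R%:E)%E).
  apply: ge0_le_integral => //.
  - exact: measurable_shell.
  - by move=> z _; exact: radial_ge0.
  - exact: measurable_radial.
  - move=> z [_ /andP[az zb]]; rewrite lee_fin; apply: ler_pM => //.
    + by rewrite invr_ge0 powR_ge0.
    + exact: psiM.
    + rewrite lef_pV2 ?posrE ?powR_gt0 ?(lt_trans a0 az)//.
      apply: ge0_ler_powR; rewrite ?nnegrE ?(ltW a0) ?enorm_ge0 ?(ltW az)//.
      by rewrite addr_ge0// mulr_ge0// ltW.
rewrite int_cst lee_fin /tau powRM ?(ltW a0) ?(ltW x0)//.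
rewrite powRD ?(gt_eqF a0) ?implybT// powR_mulrn ?(ltW a0)// !powRN.
rewrite le_eqVlt; apply/orP; left; apply/eqP; field.
by rewrite ?expf_neq0 ?gt_eqF ?powR_gt0.
Qed.

Lemma radial_shell_ge :
  ((w * (x ^+ n - 1) / x `^ (n%:R + 2 * s) * tau a)%R%:E <=
  \int[hausdorff_measure R N n]_(z in shell V a (a * x)%R) radial n z)%E.
Proof.
apply: (@le_trans _ _ (\int[hausdorff_measure R N n]_(z in shell V a (a * x)%R)
    (psi a / (a * x) `^ (n%:R + 2 * s))%R%:E)%E); last first.
  apply: ge0_le_integral => //.
  - exact: measurable_shell.
  - by move=> z _; rewrite lee_fin divr_ge0// powR_ge0.
  - exact: measurable_radial.
  - move=> z [_ /andP[az zb]]; rewrite lee_fin; apply: ler_pM => //.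
    + by rewrite invr_ge0 powR_ge0.
    + by apply: psiM; exact: ltW.
    + rewrite lef_pV2 ?posrE ?powR_gt0 ?(lt_trans a0 az)//.
      apply: ge0_ler_powR; rewrite ?nnegrE ?(ltW ax0) ?enorm_ge0//.
      by rewrite addr_ge0// mulr_ge0// ltW.
rewrite int_cst lee_fin /tau powRM ?(ltW a0) ?(ltW x0)//.
rewrite (@powRD _ a) ?(gt_eqF a0) ?implybT// powR_mulrn ?(ltW a0)// !powRN.
rewrite le_eqVlt; apply/orP; left; apply/eqP; field.
by rewrite ?expf_neq0 ?gt_eqF ?powR_gt0.
Qed.

End Shell.

Definition radial_int V e : \bar R :=
  (\int[hausdorff_measure R N (\dim V)]_(z in exterior V e) radial (\dim V) z)%E.

(* A Riemann sum in logarithmic scale; it does not depend on the dimension. *)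
Let total e x : \bar R := (\sum_(j <oo) (tau (e * x ^+ j))%R%:E)%E.

Let radial_int_rings V e x : 0 < e -> 1 < x -> (radial_int V e =
  \sum_(j <oo) \int[hausdorff_measure R N (\dim V)]_(z in
    shell V (e * x ^+ j)%R (e * x ^+ j * x)%R) radial (\dim V) z)%E.
Proof.
move=> e0 x1; rewrite /radial_int (exterior_rings _ e0 x1).
rewrite ge0_integral_bigcup; last 4 first.
- by move=> j; exact: measurable_shell.
- exact: measurable_radial.
- by move=> z _; exact: radial_ge0.
- exact: trivIset_rings.
by apply: eq_eseriesr => j _; rewrite exprSr mulrA.
Qed.

Let ring_gt0 (e x : R) (j : nat) : 0 < e -> 1 < x -> 0 < e * x ^+ j.
Proof. by move=> e0 x1; rewrite mulr_gt0// exprn_gt0// (lt_trans _ x1). Qed.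

Let radial_int_le V e x : 0 < e -> 1 < x -> (radial_int V e <=
  (unit_ball_measure (\dim V) * (x ^+ \dim V - 1) * x `^ (2 * s))%R%:E * total e x)%E.
Proof.
move=> e0 x1; rewrite (radial_int_rings V e0 x1); set w := unit_ball_measure _.
have w0 : 0 <= w * (x ^+ \dim V - 1) * x `^ (2 * s).
  rewrite mulr_ge0 ?powR_ge0// mulr_ge0 ?fine_ge0 ?hausdorff_ge0//.
  by rewrite subr_ge0 exprn_ege1// ltW.
apply: lime_le.
  by apply: is_cvg_nneseries => *; apply: integral_ge0 => *; exact: radial_ge0.
apply: nearW => k; apply: (@le_trans _ _ (\sum_(0 <= j < k)
   (w * (x ^+ \dim V - 1) * x `^ (2 * s))%R%:E * (tau (e * x ^+ j.+1))%R%:E)%E).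
  apply: lee_sum => j _; rewrite -EFinM exprSr mulrA.
  exact: radial_shell_le (ring_gt0 j e0 x1) x1.
rewrite -ge0_sume_distrr; last by move=> *; rewrite lee_fin.
apply: lee_wpmul2l; first by rewrite lee_fin.
apply: (@le_trans _ _ (\sum_(0 <= j < k.+1) (tau (e * x ^+ j))%R%:E)%E).
  by rewrite [leRHS]big_nat_recl//= leeDr// lee_fin.
by apply: nneseries_lim_ge => *; rewrite lee_fin.
Qed.

Let radial_int_ge V e x : 0 < e -> 1 < x ->
  ((unit_ball_measure (\dim V) * (x ^+ \dim V - 1)
     / x `^ ((\dim V)%:R + 2 * s))%R%:E * total e x <= radial_int V e)%E.
Proof.
move=> e0 x1; rewrite (radial_int_rings V e0 x1).
rewrite -nneseriesZl; last by move=> *; rewrite lee_fin.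
apply: lee_nneseries => [j _ _|j _]; last first.
  by rewrite -EFinM; exact: radial_shell_ge (ring_gt0 j e0 x1) x1.
rewrite mule_ge0 ?lee_fin// divr_ge0 ?powR_ge0//.
rewrite mulr_ge0 ?fine_ge0 ?hausdorff_ge0//.
by rewrite subr_ge0 exprn_ege1// ltW.
Qed.


(* Both integrals are compared with the same sum over rings; the comparison
   loses a power of the ratio x only. *)
Let radial_int_compare_ring V W e x : (0 < \dim V)%N -> (0 < \dim W)%N ->
  0 < e -> 1 < x ->
  (((\dim W)%:R * unit_ball_measure (\dim W))%:E * radial_int V e <=
   ((\dim V)%:R * unit_ball_measure (\dim V)
     * x `^ ((\dim V)%:R + (\dim W)%:R + 4 * s))%R%:E * radial_int W e)%E.
Proof.
move=> nV nW e0 x1; have x0 : 0 < x by exact: lt_trans x1.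
have := radial_int_le V e0 x1; have := radial_int_ge W e0 x1.
have wV := unit_ball_measure_gt0 (R := R) nV.
have wW := unit_ball_measure_gt0 (R := R) nW.
move: (\dim V) (\dim W) nV nW wV wW => n m nn mm.
set wn := unit_ball_measure n; set wm := unit_ball_measure m => wV wW.
have T0 : (0 <= total e x)%E by apply: nneseries_ge0 => *; rewrite lee_fin.
move=> geW leV.
have xm1 : 0 < x ^+ m - 1 by rewrite subr_gt0 exprn_egt1// -lt0n.
apply: (@le_trans _ _ ((m%:R * wm)%:E *
    ((wn * (x ^+ n - 1) * x `^ (2 * s))%R%:E * total e x))%E).
  by apply: lee_wpmul2l => //; rewrite lee_fin mulr_ge0// ltW.
apply: (@le_trans _ _ ((n%:R * wn * x `^ (n%:R + m%:R + 4 * s))%R%:E *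
    ((wm * (x ^+ m - 1) / x `^ (m%:R + 2 * s))%R%:E * total e x))%E); last first.
  by apply: lee_wpmul2l => //; rewrite lee_fin !mulr_ge0 ?powR_ge0// ltW.
rewrite !muleA -!EFinM; apply: lee_wpmul2r => //; rewrite lee_fin.
rewrite (_ : n%:R + m%:R + 4 * s = (m%:R + 2 * s) + (n%:R + 2 * s)); last by ring.
rewrite !(@powRD _ x) ?(gt_eqF x0) ?implybT// !powR_mulrn ?(ltW x0)//.
have p0 : 0 < x `^ (2 * s) by rewrite powR_gt0.
have -> : n%:R * wn * (x ^+ m * x `^ (2 * s) * (x ^+ n * x `^ (2 * s))) *
    (wm * (x ^+ m - 1) / (x ^+ m * x `^ (2 * s))) =
    wn * wm * x `^ (2 * s) * (n%:R * x ^+ n * (x ^+ m - 1)).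
  by field; rewrite !gt_eqF ?exprn_gt0.
have -> : m%:R * wm * (wn * (x ^+ n - 1) * x `^ (2 * s)) =
    wn * wm * x `^ (2 * s) * (m%:R * (x ^+ n - 1)) by ring.
rewrite ler_pM2l ?mulr_gt0// !subrX1 mulrCA [leRHS]mulrCA.
rewrite ler_pM2l ?subr_gt0//.
(* The ratio (x^n - 1) / (x^m - 1) is at most n x^n / m. *)
have sn : \sum_(i < n) x ^+ i <= n%:R * x ^+ n.
  rewrite -[leRHS](_ : \sum_(i < n) x ^+ n = _); last first.
    by rewrite sumr_const card_ord mulr_natl.
  apply: ler_sum => i _; exact: (ler_weXn2l (ltW x1) (ltnW (ltn_ord i))).
have sm : m%:R <= \sum_(i < m) x ^+ i.
  rewrite -[in leLHS](card_ord m) -sumr_const; apply: ler_sum => i _.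
  by rewrite exprn_ege1// ltW.
by rewrite mulrC ler_pM// sumr_ge0// => i _; rewrite exprn_ge0// ltW.
Qed.

Lemma radial_int_ge0 V e : (0 <= radial_int V e)%E.
Proof. by apply: integral_ge0 => z _; exact: radial_ge0. Qed.

(** The ratio of the rings is arbitrary, so the power of it that is lost can be
    any number above 1. *)
Lemma radial_int_compare V W e : (0 < \dim V)%N -> (0 < \dim W)%N -> 0 < e ->
  (((\dim W)%:R * unit_ball_measure (\dim W))%:E * radial_int V e <=
   ((\dim V)%:R * unit_ball_measure (\dim V))%:E * radial_int W e)%E.
Proof.
move=> nV nW e0; apply/lee_mul01Pr.
  by rewrite mule_ge0 ?radial_int_ge0// lee_fin mulr_ge0// fine_ge0 ?hausdorff_ge0.
move=> r /andP[r0 r1].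
pose q := (\dim V)%:R + (\dim W)%:R + 4 * s.
have q0 : 0 < q by rewrite addr_gt0 ?mulr_gt0// addr_gt0 ?ltr0n.
have x1 : 1 < (r^-1) `^ q^-1.
  by rewrite powR_gt1 ?invr_gt0// invf_gt1.
have := radial_int_compare_ring nV nW e0 x1.
rewrite -/q -powRrM mulVf ?gt_eqF// powRr1 ?invr_ge0 ?(ltW r0)//.
by rewrite [X in (_ <= X%:E * _)%E]mulrC [X in (_ <= X * _)%E]EFinM -muleA lee_pdivlMl.
Qed.

(** Polar coordinates for radial integrands, with the radial part eliminated
    between two subspaces. *)
Lemma radial_int_dim V W e : (0 < \dim V)%N -> (0 < \dim W)%N -> 0 < e ->
  (((\dim W)%:R * unit_ball_measure (\dim W))%:E * radial_int V e =
   ((\dim V)%:R * unit_ball_measure (\dim V))%:E * radial_int W e)%E.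
Proof.
by move=> nV nW e0; apply/eqP; rewrite eq_le !radial_int_compare.
Qed.

(** With rings of ratio 2 a bounded [psi] gives a geometric series of ratio
    [2^(-2s)]. *)
Lemma radial_int_lty V e M : 0 < e -> (forall r, psi r <= M) ->
  (radial_int V e < +oo)%E.
Proof.
move=> e0 psiMM; have M0 := le_trans (psi0 0) (psiMM 0).
have x1 : 1 < 2 :> R by lra.
pose q : R := 2 `^ (- (2 * s)).
have q0 : 0 < q by rewrite powR_gt0.
have q1 : q < 1 by rewrite /q powRN invf_lt1 ?powR_gt0// powR_gt1// mulr_gt0.
apply: le_lt_trans (radial_int_le V e0 x1) _.
apply: lte_mul_pinfty => //.
  rewrite lee_fin mulr_ge0 ?powR_ge0// mulr_ge0 ?fine_ge0 ?hausdorff_ge0//.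
  by rewrite subr_ge0 exprn_ege1// ltW.
apply: (@le_lt_trans _ _ (M * e `^ (- (2 * s)) / (1 - q))%:E); last by rewrite ltry.
apply: lime_le; first by apply: is_cvg_nneseries => *; rewrite lee_fin.
apply: nearW => k; rewrite sumEFin lee_fin.
apply: (@le_trans _ _ (\sum_(0 <= j < k) M * e `^ (- (2 * s)) * q ^+ j)).
  apply: ler_sum => j _; rewrite /tau powRM ?exprn_ge0// ?(ltW e0)//.
  rewrite -[2 ^+ j]powR_mulrn// -powRrM [j%:R * _]mulrC powRrM.
  rewrite powR_mulrn// -/q (powR_mulrn _ (ltW q0)) -[leRHS]mulrA; apply: ler_wpM2r => //.
  by rewrite mulr_ge0 ?powR_ge0 ?exprn_ge0 ?(ltW q0).
rewrite -mulr_sumr; apply: ler_wpM2l; first by rewrite mulr_ge0 ?powR_ge0.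
rewrite -[leRHS]mul1r ler_pdivlMr ?subr_gt0// big_mkord mulrC.
by rewrite -opprB mulNr -subrX1 opprB gerBl exprn_ge0// ltW.
Qed.

End Radial.

(** * Bounded convex profiles *)

Section Profile.
Context {R : realType}.
Variable g : R -> R.
Hypothesis gconv : convex_function (`[0, +oo[ : set R^o) g.

Lemma convex_combination p a b : 0 <= p <= 1 -> 0 <= a -> 0 <= b ->
  g (p * a + (1 - p) * b) <= p * g a + (1 - p) * g b.
Proof.
move=> /andP[p0 p1] a0 b0.
by apply: (gconv (Itv01 p0 p1)); rewrite inE/= in_itv/= andbT.
Qed.

Lemma convex_midpoint a b : `|b| <= a -> 2 * g a <= g (a + b) + g (a - b).
Proof.
rewrite ler_norml => /andP[ba1 ba2].
have h : 0 <= (2^-1 : R) <= 1 by apply/andP; split; lra.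
have ab0 : 0 <= a + b by lra.
have ab1 : 0 <= a - b by lra.
have := convex_combination h ab0 ab1.
rewrite (_ : 2^-1 * (a + b) + _ = a); last by field.
lra.
Qed.

Lemma convex_chord a b t : 0 <= a -> a < b -> b <= t ->
  (t - a) * g b <= (t - b) * g a + (b - a) * g t.
Proof.
move=> a0 ab bt.
have ta : 0 < t - a by lra.
have h : 0 <= (t - b) / (t - a) <= 1.
  by rewrite divr_ge0 ?ler_pdivrMr//=; lra.
have t0 : 0 <= t by lra.
have := convex_combination h a0 t0.
rewrite (_ : (t - b) / (t - a) * a + _ = b); last by field; rewrite gt_eqF.
rewrite -(ler_pM2l ta) => /le_trans; apply.
by rewrite le_eqVlt; apply/orP; left; apply/eqP; field; rewrite gt_eqF.
Qed.

(* An essential bound of g (|z|^2) bounds g at arbitrarily large arguments; the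
   convexity of g makes up for the exceptional set. *)
Variable M : R.
Hypothesis gM : forall T, exists2 t, T <= t & `|g t| <= M.

(** Beyond [b] the profile stays above its chord through [a] and [b]; if that
    chord increased, [g] would exceed [M] from the point [T] on. *)
Lemma bounded_convex_nonincreasing a b : 0 <= a -> a <= b -> g b <= g a.
Proof.
move=> a0; rewrite le_eqVlt => /orP[/eqP->//|ab].
rewrite leNgt; apply/negP => gab.
pose c := g b - g a; have c0 : 0 < c by rewrite subr_gt0.
have ba : 0 < b - a by rewrite subr_gt0.
pose T := b + (`|M - g b| + 1) * (b - a) / c.
have [t Tt gt] := gM T.
have bt : b <= t.
  apply: le_trans Tt; rewrite lerDl; apply: divr_ge0; last exact: ltW.
  by apply: mulr_ge0; [exact: addr_ge0|exact: ltW].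
have h1 := convex_chord a0 ab bt.
have h2 : (`|M - g b| + 1) * (b - a) <= (t - b) * c.
  rewrite -ler_pdivrMr//; move: Tt; rewrite /T; lra.
have h3 : (b - a) * (g t - g b) >= (t - b) * c by rewrite /c; nra.
have : (`|M - g b| + 1) <= g t - g b.
  rewrite -(ler_pM2l ba) (le_trans _ h3)//; lra.
have := ler_norm (M - g b); have := ler_norm (g t); lra.
Qed.

Lemma bounded_convex_ge t : 0 <= t -> - M <= g t.
Proof.
move=> t0; have [r tr] := gM t.
rewrite ler_norml => /andP[Mr _].
exact: le_trans Mr (bounded_convex_nonincreasing t0 tr).
Qed.

End Profile.

Section EssentiallyBounded.
Context {R : realType} {N : nat}.
Hypothesis N0 : (0 < N)%N.

(** The exterior of a ball contains a translate of the unit cube. *)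
Lemma hausdorff_exterior_gt0 (r : R) :
  (0 < hausdorff N [set z : 'rV[R]_N | (r < enorm z)%R])%E.
Proof.
pose v : 'rV[R]_N := const_mx (`|r| + 1).
apply: lt_le_trans (hausdorff_cube_gt0 (R := R) N0) _.
rewrite -(@hausdorff_isometry _ _ _ _ _ (fun z => z + v)); last first.
  by move=> a b _ _; rewrite opprD addrACA subrr addr0.
apply: le_hausdorff => _ [z zQ <-] /=.
apply: lt_le_trans (coord_le_enorm _ (Ordinal N0)).
have /andP[z0 z1] := zQ (Ordinal N0); rewrite !mxE.
by have := ler_norm r; have := ler_norm (z 0 (Ordinal N0) + (`|r| + 1)); lra.
Qed.

(** Otherwise [|g| > M] on a half-line, and [u] would exceed [M] on the exterior
    of a ball. *)
Lemma essentially_bounded_radial (g : R -> R) :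
  ((fun z => g (enorm z ^+ 2)) : hausdorff_mspace R N N -> R)
    \in Lfun (hausdorff_measure R N N) +oo%E ->
  exists M, forall T, exists2 t, T <= t & `|g t| <= M.
Proof.
set u := fun z => _; move=> /andP[_]; rewrite inE /= /finite_norm unlock /=.
rewrite ifT; last first.
  apply: lt_le_trans (hausdorff_exterior_gt0 0) _.
  exact: (@le_hausdorff R N N).
move=> ufin.
have [M uM] : exists M, {ae hausdorff_measure R N N, forall z, `|u z| <= M}.
  by apply: ess_supr_bounded; move: ufin; congr (_ < _)%E.
exists M => T; apply: contrapT => h.
have {}h t : T <= t -> M < `|g t|.
  by move=> Tt; rewrite ltNge; apply/negP => ?; apply: h; exists t.
have [A [mA A0 uA]] := uM.
have := hausdorff_exterior_gt0 (Num.max 1 T).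
rewrite ltNge => /negP; apply; rewrite -[leRHS]A0.
apply: (@le_hausdorff R N N) => z /=; rewrite gt_max => /andP[z1 zT].
apply: uA => /=; apply/negP; rewrite -ltNge; apply: h.
rewrite ltW// (lt_le_trans zT)// expr2 ler_peMr ?enorm_ge0 ?(ltW z1)//.
Qed.

End EssentiallyBounded.

(** * Truncated integrals *)

Section Reflection.
Context {R : realType} {N n : nat}.

Definition reflect_space (z : hausdorff_mspace R N n) : hausdorff_mspace R N n :=
  - (z : 'rV[R]_N).

Lemma hausdorff_reflect (A : set 'rV[R]_N) :
  hausdorff n (reflect_space @^-1` A) = hausdorff n A.
Proof.
rewrite -[RHS](@hausdorff_isometry _ _ _ _ _ (fun z : 'rV[R]_N => - z)).
  congr hausdorff; apply/seteqP; split => [z Az|_ [z Az <-]].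
    by exists (- z) => //; rewrite opprK.
  by rewrite /preimage/= /reflect_space opprK.
by move=> a b _ _; rewrite -opprD enormN.
Qed.

Lemma measurable_reflect : measurable_fun setT reflect_space.
Proof.
move=> _ A mA; rewrite setTI.
suff : (hausdorff_outer R N n).-caratheodory (reflect_space @^-1` A) by [].
move=> X; have {}mA : (hausdorff_outer R N n).-caratheodory A by [].
have := mA (reflect_space @^-1` X); rewrite /hausdorff_outer /=.
have E (B : set 'rV[R]_N) :
    reflect_space @^-1` X `&` B = reflect_space @^-1` (X `&` reflect_space @^-1` B).
  rewrite preimage_setI; congr (_ `&` _).
  by apply/seteqP; split => z; rewrite /preimage /= /reflect_space opprK.
by rewrite !E !hausdorff_reflect.
Qed.

Lemma integral_reflect (D : set 'rV[R]_N) (f : hausdorff_mspace R N n -> \bar R) :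
  measurable (D : set (hausdorff_mspace R N n)) ->
  (forall z, D z -> D (- z)) -> measurable_fun setT f ->
  (hausdorff_measure R N n).-integrable D (f \o reflect_space) ->
  (\int[hausdorff_measure R N n]_(z in D) f (reflect_space z) =
   \int[hausdorff_measure R N n]_(z in D) f z)%E.
Proof.
move=> mD Dsym mf fint.
have DE : reflect_space @^-1` D = D.
  apply/seteqP; split => z; last exact: Dsym.
  by move=> /Dsym; rewrite /reflect_space opprK.
have pE : pushforward (hausdorff_measure R N n) reflect_space =
    (hausdorff_measure R N n : set (hausdorff_mspace R N n) -> \bar R).
  by apply/funext => A; exact: hausdorff_reflect.
have := @integral_pushforward _ _ _ _ R _ measurable_reflect
  (hausdorff_measure R N n) D f mf.
by rewrite DE pE => /(_ fint mD) ->.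
Qed.

End Reflection.

(** An average over the two points [z] and [- z], with [f'] standing for the
    reflected [f]. *)
Lemma integral_pair_ge d (T : measurableType d) (R : realType)
    (mu : {measure set T -> \bar R}) (D : set T) (f f' h : T -> \bar R) :
  measurable D -> mu.-integrable D f -> mu.-integrable D f' ->
  mu.-integrable D h ->
  (\int[mu]_(z in D) f' z = \int[mu]_(z in D) f z)%E ->
  (forall z, 0 <= (f z + f' z) + (h z + h z))%E ->
  (- (\int[mu]_(z in D) h z) <= \int[mu]_(z in D) f z)%E.
Proof.
move=> mD fi fi' hi ff' fh.
have : (0 <= \int[mu]_(z in D) ((f z + f' z) + (h z + h z)))%E.
  by apply: integral_ge0 => z _; exact: fh.
rewrite (integralD mD (integrableD mD fi fi') (integrableD mD hi hi)).
rewrite (integralD mD fi fi') (integralD mD hi hi) ff'.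
have := integrable_fin_num mD fi; have := integrable_fin_num mD hi.
move: (integral _ _ h) (integral _ _ f) => [b| |] [a| |]//= _ _.
by rewrite -?EFinD !lee_fin; lra.
Qed.

Section Truncated.
Context {R : realType} {N : nat}.
Variables (s : R) (g : R -> R) (x : 'rV[R]_N) (M : R).
Hypotheses (s0 : 0 < s)
  (gdec : forall a b, 0 <= a -> a <= b -> g b <= g a)
  (gM : forall t, 0 <= t -> - M <= g t)
  (gmid : forall a b, `|b| <= a -> 2 * g a <= g (a + b) + g (a - b)).

Let u (z : 'rV[R]_N) := g (enorm z ^+ 2).

(** The opposite of the increment of [u] at [x] along a vector of length [r]
    orthogonal to [x].  Negative [r] are sent to 0 so that the function is
    monotone, hence measurable, on the whole line. *)
Definition decay r := g (enorm x ^+ 2) - g (enorm x ^+ 2 + Num.max 0 r ^+ 2).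

Let max0 (r : R) : 0 <= Num.max 0 r. Proof. by rewrite le_max lexx. Qed.

Lemma decay_ge0 r : 0 <= decay r.
Proof. by rewrite subr_ge0 gdec ?sqr_ge0// lerDl sqr_ge0. Qed.

Lemma decay_homo : {homo decay : a b / a <= b}.
Proof.
move=> a b ab; rewrite lerD2l lerN2 gdec ?addr_ge0 ?sqr_ge0// lerD2l.
by rewrite lerXn2r ?nnegrE// ge_max le_max lexx/= le_max ab orbT.
Qed.

Lemma decay_bound r : decay r <= g (enorm x ^+ 2) + M.
Proof. by rewrite lerD2l lerNl gM// addr_ge0 ?sqr_ge0. Qed.

Let F n (z : hausdorff_mspace R N n) : \bar R :=
  ((u (x + z) - u x) / enorm z `^ (n%:R + 2 * s))%:E.

Let measurable_F n : measurable_fun setT (@F n).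
Proof.
apply/measurable_EFinP; rewrite /F.
under eq_fun do rewrite -powRN.
have me : measurable_fun setT (fun z : hausdorff_mspace R N n => enorm z).
  by apply: measurable_lipschitz => a b; exact: enormB_le.
apply: measurable_funM; last exact: measurableT_comp (measurable_powR _) me.
apply: measurable_funB; last exact: measurable_cst.
pose G (r : R) : R := g (Num.max 0 r ^+ 2).
rewrite (_ : (fun _ => _) = G \o (fun z : hausdorff_mspace R N n => enorm (x + z))).
  suff mG : measurable_fun setT G by exact: measurableT_comp mG (measurable_enorm _).
  apply: nonincreasing_measurable => // a b ab.
  apply: gdec; rewrite ?sqr_ge0// lerXn2r ?nnegrE//.
  by rewrite ge_max le_max lexx/= le_max ab orbT.
by apply/funext => z; rewrite /= /G max_r ?enorm_ge0.
Qed.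

(* A bound of the oscillation of u. *)
Let K : R := g 0 + M.

Let K0 (r : R) : 0 <= cst K r.
Proof. by rewrite /cst /K; have := gM (lexx 0); lra. Qed.

Let F_bound n z : (`|@F n z| <= radial s (cst K) n z)%E.
Proof.
rewrite /F /radial/= lee_fin normrM ler_pM//.
  have b1 := gM (sqr_ge0 (enorm (x + z))); have b2 := gM (sqr_ge0 (enorm x)).
  have c1 := gdec (lexx 0) (sqr_ge0 (enorm (x + z))).
  have c2 := gdec (lexx 0) (sqr_ge0 (enorm x)).
  by rewrite ler_norml /u /cst /K; apply/andP; split; lra.
by rewrite ger0_norm// invr_ge0 powR_ge0.
Qed.

Let integrable_bounded V e (f : hausdorff_mspace R N (\dim V) -> \bar R) : 0 < e ->
  measurable_fun setT f ->
  (forall z, (`|f z| <= radial s (cst K) (\dim V) z)%E) ->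
  (hausdorff_measure R N (\dim V)).-integrable (exterior V e) f.
Proof.
move=> e0 mf fb.
apply: (@le_integrable _ _ _ _ _ (measurable_exterior V _ e) _
    (radial s (cst K) (\dim V))).
- exact: measurable_funTS.
- by move=> z _; rewrite [leRHS]gee0_abs ?fb ?radial_ge0.
- apply/integrableP; split; first exact: measurable_radial.
  under eq_integral => z _ do rewrite gee0_abs ?radial_ge0//.
  exact: (radial_int_lty s0 K0 _ _ e0 (fun=> lexx _)).
Qed.

Let integrable_radial V e : 0 < e ->
  (hausdorff_measure R N (\dim V)).-integrable (exterior V e)
    (radial s decay (\dim V)).
Proof.
move=> e0; apply/integrableP; split; first exact/measurable_radial/decay_homo.
under eq_integral => z _ do
  rewrite (gee0_abs (radial_ge0 s decay_ge0 _ z)).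
exact: (radial_int_lty s0 decay_ge0 decay_homo V e0 decay_bound).
Qed.

(* Midpoint convexity of g, at |x|^2 + |z|^2. *)
Let pair_ge0 n (z : hausdorff_mspace R N n) :
  (0 <= (F z + F (reflect_space z)) + (radial s decay n z + radial s decay n z))%E.
Proof.
pose v : 'rV[R]_N := z; pose w := (enorm v `^ (n%:R + 2 * s))^-1.
have w0 : 0 <= w by rewrite invr_ge0 powR_ge0.
have -> : F z = ((u (x + v) - u x) * w)%:E by [].
have -> : F (reflect_space z) = ((u (x - v) - u x) * w)%:E.
  by rewrite /F /reflect_space enormN.
have -> : radial s decay n z = (decay (enorm v) * w)%:E by [].
rewrite -!EFinD lee_fin -!mulrDl mulr_ge0//.
rewrite /decay max_r ?enorm_ge0// /u !enorm_sqr.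
have : `|2 * dot x v| <= dot x x + dot v v.
  rewrite normrM ger0_norm//.
  have := cauchy_schwarz x v; rewrite -!enorm_sqr.
  have := sqr_ge0 (enorm x - enorm v); rewrite sqrrB; lra.
move=> /gmid; rewrite !dotDl !dotDr !dotNl !dotNr (dotC v x).
rewrite (_ : dot x x + dot v v + 2 * dot x v =
    dot x x + dot x v + (dot x v + dot v v)); last by ring.
rewrite (_ : dot x x + dot v v - 2 * dot x v =
    dot x x + - dot x v + (- dot x v + - - dot v v)); last by ring.
lra.
Qed.

Let truncJE V e : truncJ s V u x e =
  (\int[hausdorff_measure R N (\dim V)]_(z in exterior V e) @F (\dim V) z)%E.
Proof. by rewrite /truncJ /exterior /F. Qed.

(** Integrability, which comes from the boundedness of [g], allows the integral to
    be averaged with its reflection. *)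
Lemma truncJ_ge V e : 0 < e ->
  (- radial_int s decay V e <= truncJ s V u x e)%E.
Proof.
move=> e0.
have iF : (hausdorff_measure R N (\dim V)).-integrable (exterior V e) (@F (\dim V)).
  exact: (integrable_bounded e0 (@measurable_F (\dim V)) (@F_bound (\dim V))).
have iFr : (hausdorff_measure R N (\dim V)).-integrable (exterior V e)
    (@F (\dim V) \o reflect_space).
  have mFr : measurable_fun setT (@F (\dim V) \o reflect_space).
    exact: (measurableT_comp (@measurable_F (\dim V))
      (@measurable_reflect R N (\dim V))).
  apply: (integrable_bounded e0 mFr) => z.
  have := @F_bound (\dim V) (reflect_space z).
  by rewrite /radial /reflect_space enormN.
have iG := integrable_radial V e0.
have mD : measurable (exterior V e : set (hausdorff_mspace R N (\dim V))).
  exact: measurable_exterior.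
have Dsym z : exterior V e z -> exterior V e (- z).
  by move=> [zV ez]; split; [rewrite memvN|rewrite enormN].
have Fint := integral_reflect mD Dsym (@measurable_F (\dim V)) iFr.
rewrite truncJE.
exact: (integral_pair_ge mD iF iFr iG Fint (@pair_ge0 (\dim V))).
Qed.

Lemma truncJ_orthogonal (V : {vspace 'rV[R]_N}) e : (forall z, z \in V -> dot x z = 0) ->
  truncJ s V u x e = (- radial_int s decay V e)%E.
Proof.
move=> Vx; rewrite /radial_int -integral_ge0N; last first.
  by move=> z _; apply: radial_ge0; exact: decay_ge0.
apply: eq_integral => z; rewrite inE => -[zV _].
rewrite -EFinN /radial -mulNr /decay max_r ?enorm_ge0// opprB /u.
by rewrite !enorm_sqr dotDl !dotDr (dotC z x) (Vx _ zV) addr0 add0r.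
Qed.

End Truncated.

(** * Principal values *)

Lemma dot_span {R : realType} {N} (a : 'rV[R]_N) (vs : seq 'rV[R]_N) v :
  (forall w, w \in vs -> dot a w = 0) -> v \in <<vs>>%VS -> dot a v = 0.
Proof.
move=> avs vV; rewrite (coord_span (X := in_tuple vs) vV) dot_sumr.
by rewrite big1// => i _; rewrite dotZr avs ?mulr0// mem_nth.
Qed.

Lemma dim_line {R : realType} {N} (y : 'rV[R]_N) : enorm y = 1 -> \dim <[y]> = 1%N.
Proof.
move=> y1; rewrite dim_vline (_ : y != 0)//.
by apply/eqP => y0; move: y1; rewrite y0 enorm0 => /eqP; rewrite eq_sym oner_eq0.
Qed.

Section PrincipalValue.
Context {R : realType} {N : nat}.
Variables (C : nat -> R -> R) (s : R) (g : R -> R) (x y : 'rV[R]_N) (M : R).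
Hypotheses (s0 : 0 < s) (C0 : forall n, (0 < n)%N -> 0 < C n s)
  (gdec : forall a b, 0 <= a -> a <= b -> g b <= g a)
  (gM : forall t, 0 <= t -> - M <= g t)
  (gmid : forall a b, `|b| <= a -> 2 * g a <= g (a + b) + g (a - b))
  (y1 : enorm y = 1).

Let u (z : 'rV[R]_N) := g (enorm z ^+ 2).
Let psi := decay g x.
Let psi0 := decay_ge0 x gdec.
Let psiM := decay_homo x gdec.

Definition line_value : \bar R :=
  lim (@radial_int R N s psi <[y]>%VS e @[e --> 0^'+]).

(** The integrand is nonnegative, so the integral increases as the excluded ball
    shrinks. *)
Lemma radial_int_cvg (V : {vspace 'rV[R]_N}) : cvg (radial_int s psi V e @[e --> 0^'+]).
Proof.
apply: nonincreasing_at_right_is_cvge; apply: nearW => r a b _ _ ab.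
apply: ge0_subset_integral.
- exact: measurable_exterior.
- exact: measurable_exterior.
- exact: measurable_radial.
- by move=> z _; exact: radial_ge0.
- by move=> z [zV bz]; split => //; exact: le_lt_trans ab bz.
Qed.

Lemma line_value_ge0 : (0 <= line_value)%E.
Proof.
by apply: lime_ge; [exact: radial_int_cvg|apply: nearW => e; exact: radial_int_ge0].
Qed.

Lemma sphere_area_gt0 n : (0 < n)%N -> 0 < sphere_area R n.
Proof. by move=> n0; rewrite mulr_gt0 ?ltr0n// unit_ball_measure_gt0. Qed.

Lemma radial_int_line (V : {vspace 'rV[R]_N}) e : (0 < \dim V)%N -> 0 < e ->
  radial_int s psi V e =
  ((sphere_area R (\dim V) / sphere_area R 1)%:E * radial_int s psi <[y]>%VS e)%E.
Proof.
move=> nV e0; have s1 := @sphere_area_gt0 1 isT.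
have := @radial_int_dim _ _ s psi s0 psi0 psiM V <[y]>%VS e nV.
rewrite dim_line// => /(_ isT e0) h.
rewrite mulrC EFinM -muleA; apply/eqP.
rewrite eq_le lee_pdivlMl// lee_pdivrMl//.
by rewrite -eq_le; apply/eqP.
Qed.

(** The principal value over an [n]-space orthogonal to [x] is [- J_coeff n] times
    the line value, as [line_value] is normalised for dimension 1. *)
Definition J_coeff n : R := C n s * (sphere_area R n / sphere_area R 1).

Lemma J_coeff_ge0 n : (0 < n)%N -> 0 <= J_coeff n.
Proof.
by move=> n0; rewrite mulr_ge0 ?divr_ge0// ltW ?C0// sphere_area_gt0.
Qed.

Let cvg_line (V : {vspace 'rV[R]_N}) : (0 < \dim V)%N ->
  (- radial_int s psi V e)%E @[e --> 0^'+] -->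
  (- ((sphere_area R (\dim V) / sphere_area R 1)%:E * line_value))%E.
Proof.
move=> nV; apply: cvgeN.
apply: (@cvg_trans _ (((sphere_area R (\dim V) / sphere_area R 1)%:E *
    radial_int s psi <[y]>%VS e)%E @[e --> 0^'+])).
  apply: near_eq_cvg.
  by apply: filterS (nbhs_right_gt 0) => e e0; rewrite (radial_int_line nV e0).
by apply: cvgeZl => //; exact: radial_int_cvg.
Qed.

Lemma Jop_orthogonal (V : {vspace 'rV[R]_N}) :
  (0 < \dim V)%N -> (forall z, z \in V -> dot x z = 0) ->
  Jop C s V u x = (- ((J_coeff (\dim V))%:E * line_value))%E.
Proof.
move=> nV Vx; rewrite /Jop (_ : lim _ =
    - ((sphere_area R (\dim V) / sphere_area R 1)%:E * line_value))%E; last first.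
  apply: cvg_lim => //; under eq_fun do rewrite truncJ_orthogonal//.
  exact: cvg_line.
by rewrite muleN muleA -EFinM.
Qed.

(** Passage to the limit in the bound on truncated integrals.  The bound is
    nonpositive, so it also lies below 0, the value that the limit takes by
    convention when the truncated integrals do not converge. *)
Lemma Jop_ge (V : {vspace 'rV[R]_N}) : (0 < \dim V)%N ->
  (- ((J_coeff (\dim V))%:E * line_value) <= Jop C s V u x)%E.
Proof.
move=> nV; rewrite /J_coeff EFinM -muleA -muleN /Jop; apply: lee_wpmul2l.
  by rewrite lee_fin ltW// C0.
have [cV|cV] := pselect (cvg (truncJ s V u x e @[e --> 0^'+])); last first.
  rewrite (dvgP cV) leeNl oppe0 mule_ge0 ?line_value_ge0// lee_fin.
  by rewrite divr_ge0// ltW// sphere_area_gt0.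
rewrite -(cvg_lim _ (cvg_line nV))//; apply: lee_lim => //.
  by apply/cvg_ex; eexists; exact: cvg_line.
apply: filterS (nbhs_right_gt 0) => e e0.
exact: (@truncJ_ge _ _ _ _ x M s0 gdec gM gmid V e e0).
Qed.

End PrincipalValue.

Theorem lemmaA1 (R : realType) (N l : nat) (k : 'I_l -> nat) (s : R)
    (C : nat -> R -> R) (g : R -> R) (x : 'rV[R]_N) :
  (1 <= l <= N)%N ->
  (forall i, (1 <= k i <= N)%N) ->
  (forall i j : 'I_l, (i <= j)%N -> (k i <= k j)%N) ->
  (\sum_(i < l) k i < N)%N ->
  0 < s < 1 ->
  (forall (n : nat) (t : R), (0 < n)%N -> 0 < t < 1 -> 0 < C n t) ->
  let u := fun z : 'rV[R]_N => g (enorm z ^+ 2) in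
  (u : hausdorff_mspace R N N -> R)
    \in Lfun (hausdorff_measure R N N) +oo%E ->
  convex_function (`[0, +oo[ : set R^o) g ->
  x != 0 ->
  forall (eta : forall i : 'I_l, 'I_(k i) -> 'rV[R]_N) (y : 'rV[R]_N),
  (forall p q : {i : 'I_l & 'I_(k i)},
    dot (eta (tag p) (tagged p)) (eta (tag q) (tagged q)) = (p == q)%:R) ->
  (forall i j, dot (eta i j) x = 0) ->
  enorm y = 1 ->
  dot y x = 0 ->
  Kminus C s k u x = (\sum_(i < l) Jop C s <<codom (eta i)>>%VS u x)%E /\
  (\sum_(i < l) Jop C s <<codom (eta i)>>%VS u x)%E =
    (((\sum_(i < l) C (k i) s * sphere_area R (k i))
        / (C 1%N s * sphere_area R 1))%R%:E * Iop C s y u x)%E.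
Proof.
move=> lN kN _ _ /andP[s0 s1] Cpos u uL gconv x0 eta y etaO etax y1 yx.
have N0 : (0 < N)%N by case/andP: lN; exact: leq_trans.
have C0 n : (0 < n)%N -> 0 < C n s by move=> n0; rewrite Cpos// s0 s1.
have [M gM] := essentially_bounded_radial N0 uL.
have gdec := bounded_convex_nonincreasing gconv gM.
have gge := bounded_convex_ge gconv gM.
have gmid := convex_midpoint gconv.
have k0 i : (0 < k i)%N by case/andP: (kN i).
pose L := line_value s g x y.
have L0 : (0 <= L)%E by exact: line_value_ge0.
pose V i := <<codom (eta i)>>%VS.
pose pair i a : {i : 'I_l & 'I_(k i)} := @existT 'I_l (fun i => 'I_(k i)) i a.
have eta_same i a b : dot (eta i a) (eta i b) = (a == b)%:R.
  by rewrite (etaO (pair i a) (pair i b)) eq_Tagged.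
have eta_other i j a b : i != j -> dot (eta i a) (eta j b) = 0.
  move=> ij; rewrite (etaO (pair i a) (pair j b)).
  rewrite (_ : (_ == _) = false)//; apply/negbTE.
  by apply: contraNneq ij => /(congr1 tag)/= ->.
have etaO1 i : dot_orthonormal (codom (eta i)).
  move=> a b; rewrite size_codom card_ord => ak bk.
  have nthE j (jk : (j < k i)%N) : (codom (eta i))`_j = eta i (Ordinal jk).
    by rewrite (nth_map (Ordinal jk)) ?size_enum_ord// (nth_ord_enum _ (Ordinal jk)).
  by rewrite (nthE a ak) (nthE b bk) eta_same.
have dimV i : \dim (V i) = k i.
  have /eqP -> := dot_orthonormal_free (etaO1 i).
  by rewrite size_codom card_ord.
have VO : orthogonal_family k V.
  split=> // i j ij v w vi wj.
  apply: (dot_span _ wj) => _ /codomP[b ->]; rewrite dotC.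
  apply: (dot_span _ vi) => _ /codomP[a ->].
  by rewrite dotC eta_other.
have JV i : Jop C s (V i) u x = (- ((J_coeff C s (k i))%:E * L))%E.
  rewrite -dimV; apply: Jop_orthogonal; rewrite ?dimV// => z zV.
  by apply: (dot_span _ zV) => _ /codomP[a ->]; rewrite dotC.
have JE : (\sum_(i < l) Jop C s (V i) u x =
    - ((\sum_(i < l) J_coeff C s (k i))%:E * L))%E.
  under eq_bigr do rewrite JV.
  rewrite -sumEFin ge0_sume_distrl; last by move=> i _; rewrite lee_fin J_coeff_ge0.
  apply: sumeN => i j _ _; apply: ge0_adde_def;
    by rewrite inE mule_ge0// lee_fin J_coeff_ge0.
split.
  apply/eqP; rewrite eq_le; apply/andP; split.
    by apply: ereal_inf_lbound; exists V.
  apply: le_ereal_inf_tmp => _ [W [dimW _] <-].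
  apply: lee_sum => i _; rewrite JV -dimW.
  apply: (@Jop_ge _ _ C s g x y M s0 C0 gdec gge gmid y1).
  by rewrite dimW.
have Jy : Iop C s y u x = (- ((J_coeff C s 1)%:E * L))%E.
  have lineE := Jop_orthogonal C s0 gdec y1 (V := <[y]>%VS).
  rewrite /Iop lineE ?dim_line// => z.
  by move=> /vlineP[a ->]; rewrite dotZr dotC yx mulr0.
have c1 := C0 1%N isT; have a1 := @sphere_area_gt0 R 1 isT.
rewrite JE Jy muleN muleA -EFinM; congr (- (_%:E * _))%E.
rewrite /J_coeff divff ?gt_eqF// mulr1.
transitivity ((\sum_(i < l) C (k i) s * sphere_area R (k i)) / sphere_area R 1).
  by rewrite mulr_suml; apply: eq_bigr => i _; rewrite mulrA.
by field; rewrite !gt_eqF.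
Qed.
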